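(* For any fixed $k>4$, the query realizability problem for $\mathrm{FO}(k)$ is $\mathsf{EXPTIME}$-hard: the problem of deciding, given pairs $\langle A_1,\mathit{Ans}_1\rangle,\dots,\langle A_m,\mathit{Ans}_m\rangle$ of finite $\tau$-structures and answer sets $\mathit{Ans}_i\subseteq\mathrm{dom}(A_i)^r$, and a regular tree grammar $G$ over $\Sigma_{\mathrm{FO}(k)}$, whether there is a formula $\varphi(x_1,\dots,x_r)\in L(G)$ with exactly $r$ distinct free variables such that $\{\bar a\in\mathrm{dom}(A_i)^r: A_i\models\varphi(\bar a)\}=\mathit{Ans}_i$ for all $i$.
   Context: A signature $\tau$ is a finite set of relation, function and constant symbols with arities; structures are finite. $\mathrm{FO}$ is first-order logic with if-then-else terms: formulas $\varphi::=R(\bar t)\mid\varphi\vee\varphi\mid\varphi\wedge\varphi\mid\neg\varphi\mid\exists x.\varphi\mid\forall x.\varphi$, terms $t::=x\mid c\mid f(\bar t)\mid\mathsf{ite}(\varphi,t,t')$. $\mathrm{FO}(k)$ is the fragment using only the $k$ variables $V=\{x_1,\dots,x_k\}$ (reusable). Formulas are trees over the ranked alphabet $\Sigma_{\mathrm{FO}(k)}=\{R^{\mathrm{ar}(R)},f^{\mathrm{ar}(f)}:R,f\in\tau\}\cup\{\mathsf{ite}^3,\wedge^2,\vee^2,\neg^1\}\cup\{\forall x^1,\exists x^1,x^0:x\in V\}$. A regular tree grammar $G=\langle N,\Sigma,S,P\rangle$ has nonterminals $N$, axiom $S$ and rules $B\to t$ ($t$ a tree over $\Sigma\cup N$); $L(G)$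 is the set of trees over $\Sigma$ derivable from $S$. *)

(* Defs.v *)
From mathcomp Require Import all_boot.
From Stdlib Require Import Relation_Operators.
From Stdlib Require List.

Set Implicit Arguments.
Unset Strict Implicit.
Unset Printing Implicit Defensive.

(** * Deterministic multi-tape Turing machines *)

(* [None] is the blank, [Some (inl b)] an input/output bit and [Some (inr a)]
   one of the additional symbols of the machine. *)
Definition cell (A : finType) : finType := option (bool + A)%type.

Inductive direction := Left | Stay | Right.

(* A two-way infinite tape: [before] lists the cells to the left of the head,
   nearest first; all cells not listed are blank. *)
Record tape (A : finType) := Tape {
  before : seq (cell A);
  scanned : cell A;
  after : seq (cell A)
}.

Definition write (A : finType) (a : cell A) (t : tape A) : tape A :=
  Tape (before t) a (after t).

Definition shift (A : finType) (d : direction) (t : tape A) : tape A :=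
  match d with
  | Left => Tape (behead (before t)) (head None (before t))
                 (scanned t :: after t)
  | Stay => t
  | Right => Tape (scanned t :: before t) (head None (after t))
                  (behead (after t))
  end.

Definition tape_of_word (A : finType) (w : seq bool) : tape A :=
  let s := [seq Some (inl b) : cell A | b <- w] in
  Tape [::] (head None s) (behead s).

Fixpoint leading_bits (A : finType) (s : seq (cell A)) : seq bool :=
  if s is Some (inl b) :: s' then b :: leading_bits s' else [::].

(* The tapes are indexed by ['I_(extra_tapes.+1)]: the input is on the first
   one, and an output, if any, is read off the last one. *)
Record machine := Machine {
  extra_tapes : nat;
  state : finType;
  letter : finType;
  start : state;
  halting : pred state;
  accepting : pred state;
  transition : state -> {ffun 'I_extra_tapes.+1 -> cell letter} ->
    state * ('I_extra_tapes.+1 -> cell letter * direction)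
}.

Record config (M : machine) := Config {
  current : state M;
  tapes : 'I_(extra_tapes M).+1 -> tape (letter M)
}.

Definition init (M : machine) (w : seq bool) : config M :=
  Config (start M)
    (fun i => tape_of_word (letter M) (if i == ord0 then w else [::])).

Definition step (M : machine) (c : config M) : config M :=
  if halting (current c) then c else
  let: (q, act) :=
    transition (current c) [ffun i => scanned (tapes c i)] in
  Config q (fun i => shift (act i).2 (write (act i).1 (tapes c i))).

Definition run (M : machine) (w : seq bool) (t : nat) : config M :=
  iter t (@step M) (init M w).

Definition halted (M : machine) (c : config M) : bool := halting (current c).

(* The longest word of bits that starts under the head of the last tape. *)
Definition output (M : machine) (c : config M) : seq bool :=
  let t := tapes c ord_max in leading_bits (scanned t :: after t).

(** * EXPTIME-hardness *)

Definition language := seq bool -> Prop.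

Definition decidable_in_time (T : nat -> nat) (L : language) : Prop :=
  exists M : machine, forall w, exists t,
    [/\ t <= T (size w), halted (run M w t)
      & accepting (current (run M w t)) <-> L w].

Definition computable_in_time (T : nat -> nat) (f : seq bool -> seq bool) :
    Prop :=
  exists M : machine, forall w, exists t,
    [/\ t <= T (size w), halted (run M w t) & output (run M w t) = f w].

(* Every polynomial is dominated by some [n ^ c + c]. *)
Definition EXPTIME (L : language) : Prop :=
  exists c, decidable_in_time (fun n => 2 ^ (n ^ c + c)) L.

Definition polytime (f : seq bool -> seq bool) : Prop :=
  exists c, computable_in_time (fun n => n ^ c + c) f.

Definition polytime_reducible (L L' : language) : Prop :=
  exists f, polytime f /\ (forall w, L w <-> L' (f w)).

Definition EXPTIME_hard (L : language) : Prop :=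
  forall L', EXPTIME L' -> polytime_reducible L' L.

(** * Finite structures *)

(* Only the arities matter, since the symbols are numbered. Constant symbols
   are the function symbols of arity 0. *)
Record signature := Signature {
  rel_arities : seq nat;
  fun_arities : seq nat
}.

Definition rel_symbol (tau : signature) := 'I_(size (rel_arities tau)).
Definition fun_symbol (tau : signature) := 'I_(size (fun_arities tau)).

Definition rel_ar (tau : signature) (R : rel_symbol tau) : nat :=
  nth 0 (rel_arities tau) R.
Definition fun_ar (tau : signature) (f : fun_symbol tau) : nat :=
  nth 0 (fun_arities tau) f.

(* Domains are nonempty; up to isomorphism they are initial segments of nat. *)
Record structure (tau : signature) := Structure {
  max_elt : nat;
  rel_int : forall R : rel_symbol tau, {set (rel_ar R).-tuple 'I_max_elt.+1};
  fun_int : forall f : fun_symbol tau,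
    {ffun (fun_ar f).-tuple 'I_max_elt.+1 -> 'I_max_elt.+1}
}.

Definition dom (tau : signature) (A : structure tau) : finType :=
  'I_(max_elt A).+1.

(** * First-order logic with [k] variables and if-then-else terms *)

Inductive term (tau : signature) (k : nat) : Type :=
  | Var of 'I_k
  | App (f : fun_symbol tau) of ('I_(fun_ar f) -> term tau k)
  | Ite of formula tau k & term tau k & term tau k
with formula (tau : signature) (k : nat) : Type :=
  | Atom (R : rel_symbol tau) of ('I_(rel_ar R) -> term tau k)
  | Or of formula tau k & formula tau k
  | And of formula tau k & formula tau k
  | Not of formula tau k
  | Exists of 'I_k & formula tau k
  | Forall of 'I_k & formula tau k.

Definition update (k : nat) (T : Type) (e : 'I_k -> T) (x : 'I_k) (a : T) :
    'I_k -> T :=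
  fun y => if y == x then a else e y.

Fixpoint value (tau : signature) (k : nat) (A : structure tau)
    (e : 'I_k -> dom A) (t : term tau k) {struct t} : dom A :=
  match t with
  | Var x => e x
  | App f ts => fun_int A f [tuple value e (ts i) | i < fun_ar f]
  | Ite phi t1 t2 => if holds e phi then value e t1 else value e t2
  end
with holds (tau : signature) (k : nat) (A : structure tau)
    (e : 'I_k -> dom A) (phi : formula tau k) {struct phi} : bool :=
  match phi with
  | Atom R ts => [tuple value e (ts i) | i < rel_ar R] \in rel_int A R
  | Or phi1 phi2 => holds e phi1 || holds e phi2
  | And phi1 phi2 => holds e phi1 && holds e phi2
  | Not phi1 => ~~ holds e phi1
  | Exists x phi1 => [exists a : dom A, holds (update e x a) phi1]
  | Forall x phi1 => [forall a : dom A, holds (update e x a) phi1]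
  end.

Fixpoint term_fv (tau : signature) (k : nat) (t : term tau k) {struct t} :
    {set 'I_k} :=
  match t with
  | Var x => [set x]
  | App f ts => \bigcup_(i < fun_ar f) term_fv (ts i)
  | Ite phi t1 t2 => fv phi :|: term_fv t1 :|: term_fv t2
  end
with fv (tau : signature) (k : nat) (phi : formula tau k) {struct phi} :
    {set 'I_k} :=
  match phi with
  | Atom R ts => \bigcup_(i < rel_ar R) term_fv (ts i)
  | Or phi1 phi2 => fv phi1 :|: fv phi2
  | And phi1 phi2 => fv phi1 :|: fv phi2
  | Not phi1 => fv phi1
  | Exists x phi1 => fv phi1 :\ x
  | Forall x phi1 => fv phi1 :\ x
  end.

(* [phi(x_1, ..., x_r)]: the free variables are the first [r] variables, and
   there really are [r] of them (in particular [r <= k]). *)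
Definition free_exactly (tau : signature) (k r : nat) (phi : formula tau k) :
    Prop :=
  fv phi = [set x : 'I_k | x < r] /\ #|fv phi| = r.

(* The value [ord0] given to the variables beyond the [r]-th is immaterial when
   [free_exactly r phi]. *)
Definition answers (tau : signature) (k r : nat) (A : structure tau)
    (phi : formula tau k) : {set r.-tuple (dom A)} :=
  [set a : r.-tuple (dom A) | holds (fun x => nth ord0 a x) phi].

(** * Ranked trees and regular tree grammars *)

Inductive tree (S : Type) (rank : S -> nat) : Type :=
  Node (s : S) of ('I_(rank s) -> tree rank).

(* The alphabet [S] together with [N] nonterminals of rank 0. *)
Definition ext_rank (S : Type) (rank : S -> nat) (N : nat)
    (s : S + 'I_N) : nat :=
  match s with inl s => rank s | inr _ => 0 end.

Record grammar (S : Type) (rank : S -> nat) := Grammar {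
  nonterminals : nat;
  axiom : 'I_nonterminals;
  rules : seq ('I_nonterminals * tree (@ext_rank S rank nonterminals))
}.

Section Grammars.
Variables (S : Type) (rank : S -> nat).

Definition leaf (N : nat) (B : 'I_N) : tree (@ext_rank S rank N) :=
  @Node _ (@ext_rank S rank N) (inr B) (fun i => False_rect _ (notF (ltn_ord i))).

Fixpoint embed (N : nat) (t : tree rank) : tree (@ext_rank S rank N) :=
  match t with
  | Node s ts => @Node _ (@ext_rank S rank N) (inl s) (fun i => embed N (ts i))
  end.

Inductive rewrites (G : grammar rank) :
    tree (@ext_rank S rank (nonterminals G)) ->
    tree (@ext_rank S rank (nonterminals G)) -> Prop :=
  | rewrite_rule B t : List.In (B, t) (rules G) -> rewrites (leaf B) t
  | rewrite_child s ts ts' i :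
      rewrites (ts i) (ts' i) -> (forall j, j != i -> ts' j = ts j) ->
      rewrites (Node ts) (@Node _ _ s ts').

Definition generated (G : grammar rank) (t : tree rank) : Prop :=
  clos_refl_trans _ (@rewrites G) (leaf (axiom G)) (embed _ t).

End Grammars.

Inductive fo_symbol (tau : signature) (k : nat) : Type :=
  | SRel of rel_symbol tau
  | SFun of fun_symbol tau
  | SIte | SAnd | SOr | SNot
  | SForall of 'I_k
  | SExists of 'I_k
  | SVar of 'I_k.
Arguments SRel {tau k}.
Arguments SFun {tau k}.
Arguments SIte {tau k}.
Arguments SAnd {tau k}.
Arguments SOr {tau k}.
Arguments SNot {tau k}.
Arguments SForall {tau k}.
Arguments SExists {tau k}.
Arguments SVar {tau k}.

Definition fo_rank (tau : signature) (k : nat) (s : fo_symbol tau k) : nat :=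
  match s with
  | SRel R => rel_ar R
  | SFun f => fun_ar f
  | SIte => 3
  | SAnd | SOr => 2
  | SNot | SForall _ | SExists _ => 1
  | SVar _ => 0
  end.

Definition fo_tree (tau : signature) (k : nat) := tree (@fo_rank tau k).
Definition fo_grammar (tau : signature) (k : nat) := grammar (@fo_rank tau k).

Definition fo_node (tau : signature) (k : nat) (s : fo_symbol tau k)
    (ts : (fo_rank s).-tuple (fo_tree tau k)) : fo_tree tau k :=
  Node (tnth ts).

Fixpoint tree_of_term (tau : signature) (k : nat) (t : term tau k) {struct t} :
    fo_tree tau k :=
  match t with
  | Var x => fo_node (s := SVar x) [tuple]
  | App f ts => @Node _ (@fo_rank tau k) (SFun f) (fun i => tree_of_term (ts i))
  | Ite phi t1 t2 =>
      fo_node (s := SIte)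
        [tuple tree_of_formula phi; tree_of_term t1; tree_of_term t2]
  end
with tree_of_formula (tau : signature) (k : nat) (phi : formula tau k)
    {struct phi} : fo_tree tau k :=
  match phi with
  | Atom R ts => @Node _ (@fo_rank tau k) (SRel R) (fun i => tree_of_term (ts i))
  | Or phi1 phi2 =>
      fo_node (s := SOr) [tuple tree_of_formula phi1; tree_of_formula phi2]
  | And phi1 phi2 =>
      fo_node (s := SAnd) [tuple tree_of_formula phi1; tree_of_formula phi2]
  | Not phi1 => fo_node (s := SNot) [tuple tree_of_formula phi1]
  | Exists x phi1 => fo_node (s := SExists x) [tuple tree_of_formula phi1]
  | Forall x phi1 => fo_node (s := SForall x) [tuple tree_of_formula phi1]
  end.

(** * The query realizability problem *)

Record instance (k : nat) := Instance {
  sig : signature;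
  num_vars : nat;
  examples :
    seq {A : structure sig & {set num_vars.-tuple (dom A)}};
  gram : fo_grammar sig k
}.

Definition realizable (k : nat) (I : instance k) : Prop :=
  exists phi : formula (sig I) k,
    [/\ generated (gram I) (tree_of_formula phi),
        free_exactly (num_vars I) phi
      & forall E, List.In E (examples I) ->
          answers (num_vars I) (projT1 E) phi = projT2 E].

(** * Encoding of instances as words

    An instance is first written as a sequence of natural numbers, in which
    every list is preceded by its length unless this length is determined by
    what comes before. Relations and answer sets are written as their
    characteristic tables, functions as their tables of values, and trees in
    prefix notation. *)

(* All [a]-tuples over [s], in lexicographic order. *)
Fixpoint lex_tuples (T : Type) (s : seq T) (a : nat) : seq (a.-tuple T) :=
  match a with
  | 0 => [:: [tuple]]
  | a'.+1 => [seq cons_tuple x t | x <- s, t <- lex_tuples s a']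
  end.

Definition enc_set (n a : nat) (X : {set a.-tuple 'I_n}) : seq nat :=
  [seq nat_of_bool (t \in X) | t <- lex_tuples (enum 'I_n) a].

Definition enc_fun (n a : nat) (g : {ffun a.-tuple 'I_n -> 'I_n}) : seq nat :=
  [seq nat_of_ord (g t) | t <- lex_tuples (enum 'I_n) a].

Definition enc_signature (tau : signature) : seq nat :=
  size (rel_arities tau) :: rel_arities tau ++
  size (fun_arities tau) :: fun_arities tau.

Definition enc_structure (tau : signature) (A : structure tau) : seq nat :=
  (max_elt A).+1 ::
  flatten [seq enc_set (rel_int A R) | R <- enum (rel_symbol tau)] ++
  flatten [seq enc_fun (fun_int A f) | f <- enum (fun_symbol tau)].

Definition enc_example (tau : signature) (r : nat)
    (E : {A : structure tau & {set r.-tuple (dom A)}}) : seq nat :=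
  enc_structure (projT1 E) ++ enc_set (projT2 E).

Definition enc_symbol (tau : signature) (k N : nat)
    (s : fo_symbol tau k + 'I_N) : seq nat :=
  match s with
  | inl (SRel R) => [:: 0; nat_of_ord R]
  | inl (SFun f) => [:: 1; nat_of_ord f]
  | inl SIte => [:: 2]
  | inl SAnd => [:: 3]
  | inl SOr => [:: 4]
  | inl SNot => [:: 5]
  | inl (SForall x) => [:: 6; nat_of_ord x]
  | inl (SExists x) => [:: 7; nat_of_ord x]
  | inl (SVar x) => [:: 8; nat_of_ord x]
  | inr B => [:: 9; nat_of_ord B]
  end.

Fixpoint enc_tree (S : Type) (rank : S -> nat) (enc : S -> seq nat)
    (t : tree rank) : seq nat :=
  match t with
  | Node s ts =>
      enc s ++ flatten [seq enc_tree enc (ts i) | i <- enum 'I_(rank s)]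
  end.

Definition enc_grammar (tau : signature) (k : nat) (G : fo_grammar tau k) :
    seq nat :=
  [:: nonterminals G, nat_of_ord (axiom G), size (rules G) &
    flatten [seq nat_of_ord p.1 ::
                 enc_tree (@enc_symbol tau k (nonterminals G)) p.2
            | p <- rules G]].

Definition enc_instance (k : nat) (I : instance k) : seq nat :=
  enc_signature (sig I) ++
  [:: num_vars I, size (examples I) &
    flatten [seq enc_example E | E <- examples I]] ++
  enc_grammar (gram I).

(* Numbers are written in unary: all of them are arities, sizes of explicitly
   listed objects, or indices into such objects. *)
Definition unary (s : seq nat) : seq bool :=
  flatten [seq rcons (nseq n true) false | n <- s].

Definition encode (k : nat) (I : instance k) : seq bool :=
  unary (enc_instance I).

Definition query_realizability (k : nat) : language :=
  fun w => exists I : instance k, w = encode I /\ realizable I.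

(* Main.v *)
Require Import Defs.
From mathcomp Require Import all_boot.
From mathcomp Require Import zify.
From Stdlib Require Import FunctionalExtensionality Relation_Operators.

Set Implicit Arguments.
Unset Strict Implicit.
Unset Printing Implicit Defensive.

(* A structure whose functions are the transition functions of a deterministic
   bottom-up tree automaton evaluates a ground term to the state reached on it.
   Hence, with no free variable and a grammar generating the atoms P(t) with t
   ground, realizability asks whether several automata, one per example, accept
   a common tree; the number of variables plays no role.

   A tree can be read as a derivation whose facts are the vectors of the states
   of all the automata. One automaton holds a control part of constant size, and
   the j-th other one holds the j-th bits of two clocks. This suffices to
   simulate 2^poly(n) steps of a machine: a tape is a pair of stacks, and a stack
   is a linked list in time, described by the facts "at time t the stack k has
   top a, and what is below it is the stack k as it was at time t'". Incrementing
   a clock at bit l is one function symbol for each l, so that every table of the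
   instance is one of finitely many constant lists, chosen by comparing l with j
   or by reading an input bit. Such an instance is printed by nested loops over
   polynomially bounded counters, which a Turing machine keeps as positions of
   its heads. *)

(** * Instances can be decoded *)

(** The obstacle is that times are exponentially large, while every structure is given by explicit
    tables and cannot store one. Splitting a time into bits works because the automata need not
    communicate: they read the same tree, and its symbols announce what a single automaton cannot
    see. Equality of times is a bitwise test, and an increment becomes one as soon as the position
    of the carry is announced. A wrong announcement kills some automaton. Two clocks are carried
    because a stack cell points from one time to another.

    The automaton for the control sees no clock, yet at step i of loading it must read the letter
    belonging to i. The clock therefore passes through the values 2^i - 1 during loading: such a
    jump is possible only under the symbol of index i, which thereby reveals the step.

    Soundness uses determinism: there is one configuration per time, so premises with equal times
    speak of the same configuration. For completeness the size of the tree is irrelevant, and a fact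
    may be derived anew wherever it is used. *)

Lemma unary_inj : injective unary.
Proof.
rewrite /unary; elim=> [|n s IH] [|n' s'] //=.
- by case: n'.
- by case: n.
elim: n n' => [|n IHn] [|n'] //= [].
- by move/IH ->.
- by move/IHn => [-> ->].
Qed.

(** Injectivity alone does not survive concatenation. What does is that a code can be split off any
    word beginning with it, leaving a determined rest. *)
Definition prefix_code (T : Type) (e : T -> seq nat) : Prop :=
  forall a b x y, e a ++ x = e b ++ y -> a = b /\ x = y.

Lemma eq_cat_size (T : eqType) (a b x y : seq T) :
  size a = size b -> a ++ x = b ++ y -> a = b /\ x = y.
Proof. by move=> eq_sz /eqP; rewrite eqseq_cat // => /andP[/eqP -> /eqP ->]. Qed.

Lemma flatten_prefix_code (T : Type) (e : T -> seq nat) l l' x y :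
  prefix_code e -> size l = size l' ->
  flatten (map e l) ++ x = flatten (map e l') ++ y -> l = l' /\ x = y.
Proof.
move=> pe; elim: l l' => [|a l IH] [|b l'] //= [eq_sz].
by rewrite -!catA => /pe[-> /(IH _ eq_sz)[-> ->]].
Qed.

(** The hypothesis concerns only the values [f i] and [g i], so that the induction hypothesis on
    subtrees can supply it in [enc_tree_prefix_code]. *)
Lemma flatten_family_inj (I : finType) (T : I -> Type) (e : forall i, T i -> seq nat)
    (f g : forall i, T i) x y :
  (forall i u v, e i (f i) ++ u = e i (g i) ++ v -> f i = g i /\ u = v) ->
  flatten [seq e i (f i) | i <- enum I] ++ x = flatten [seq e i (g i) | i <- enum I] ++ y ->
  f = g /\ x = y.
Proof.
move=> pe; suff H l : flatten [seq e i (f i) | i <- l] ++ x =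
    flatten [seq e i (g i) | i <- l] ++ y -> (forall i, i \in l -> f i = g i) /\ x = y.
  move=> /H[eq_fg ->]; split=> //.
  by apply: functional_extensionality_dep => i; apply: eq_fg; rewrite mem_enum.
elim: l => [|i l IH] //=; rewrite -!catA => /pe[eq_i /IH[eq_l ->]]; split=> // j.
by rewrite inE => /predU1P[->|/eq_l].
Qed.

Lemma mem_lex_tuples (T : eqType) (s : seq T) a (t : a.-tuple T) :
  all (mem s) t -> t \in lex_tuples s a.
Proof.
elim: a t => [|a IH] t; first by rewrite tuple0 inE.
case: (tupleP t) => x u /= /andP[xs us].
by apply/allpairsP; exists (x, u); split=> //=; apply: IH.
Qed.

Lemma mem_lex_enum n a (t : a.-tuple 'I_n) : t \in lex_tuples (enum 'I_n) a.
Proof. by apply: mem_lex_tuples; apply/allP => i _; rewrite inE mem_enum. Qed.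

Lemma enc_set_prefix_code n a : prefix_code (@enc_set n a).
Proof.
move=> X Y x y; rewrite /enc_set => /eq_cat_size[]; first by rewrite !size_map.
move/eq_in_map => eqXY ->; split=> //; apply/setP => t.
by have := eqXY t (mem_lex_enum t); do 2!case: (t \in _).
Qed.

Lemma enc_fun_prefix_code n a : prefix_code (@enc_fun n a).
Proof.
move=> f g x y; rewrite /enc_fun => /eq_cat_size[]; first by rewrite !size_map.
move/eq_in_map => eq_fg ->; split=> //; apply/ffunP => t.
by apply: ord_inj; apply: (eq_fg t (mem_lex_enum t)).
Qed.

Lemma enc_structure_prefix_code tau : prefix_code (@enc_structure tau).
Proof.
case=> n r f [n' r' f'] x y; rewrite /enc_structure /= => -[eq_n].
(* The types of both tables depend on the domain size, which is read first; only after identifying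
   it can they be compared. *)
rewrite -eq_n in r' f' *; rewrite -!catA.
move/(@flatten_family_inj _ _ (fun R => @enc_set n.+1 (rel_ar R)) r r' _ _
        (fun R => @enc_set_prefix_code _ _ _ _)) => [-> ].
by move/(@flatten_family_inj _ _ (fun R => @enc_fun n.+1 (fun_ar R)) f f' _ _
        (fun R => @enc_fun_prefix_code _ _ _ _)) => [-> ->].
Qed.

Lemma enc_example_prefix_code tau r : prefix_code (@enc_example tau r).
Proof.
case=> A X [B Y] x y; rewrite /enc_example -!catA.
move/enc_structure_prefix_code => [/= eqAB]; rewrite -eqAB in Y *.
by move/enc_set_prefix_code => [-> ->].
Qed.

Lemma enc_symbol_prefix_code tau k N : prefix_code (@enc_symbol tau k N).
Proof.
case=> [[R|f|||||z|z|z]|B] [[R'|f'|||||z'|z'|z']|B'] x y; rewrite /=;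
  (try discriminate); case; (try by move=> ->); by move=> /ord_inj -> ->.
Qed.

(** The symbol at the root fixes the number of subtrees that follow, so no lengths are needed. *)
Lemma enc_tree_prefix_code (S : Type) (rank : S -> nat) (enc : S -> seq nat) :
  prefix_code enc -> prefix_code (@enc_tree S rank enc).
Proof.
move=> pe; elim=> s ts IH [s' ts'] x y /=; rewrite -!catA.
move=> /pe[eq_s]; rewrite -eq_s in ts' *.
by move/(@flatten_family_inj _ _ (fun=> @enc_tree S rank enc) ts ts' _ _
        (fun i u v => IH i _ u v)) => [-> ->].
Qed.

Lemma enc_signature_prefix_code : prefix_code enc_signature.
Proof.
case=> r f [r' f'] x y; rewrite /enc_signature /= -!catA => -[eq_sz].
move/(eq_cat_size eq_sz) => [-> /= [eq_sz']].
by move/(eq_cat_size eq_sz') => [-> ->].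
Qed.

(** [query_realizability] speaks of some instance encoded by the word; injectivity makes it the
    constructed one in the converse direction of the reduction. *)
Lemma encode_inj k : injective (@encode k).
Proof.
case=> tau r X G [tau' r' X' G'] /unary_inj; rewrite /enc_instance /=.
move/enc_signature_prefix_code => [eq_tau]; rewrite -eq_tau in X' G' *.
case=> eq_r; rewrite -eq_r in X' * => eq_sz.
move/(flatten_prefix_code (@enc_example_prefix_code _ _) eq_sz) => [->].
case: G G' => [N B P] [N' B' P']; rewrite /enc_grammar /=.
case=> eq_N; rewrite -eq_N in B' P' * => /ord_inj <- eq_szP.
have pe : prefix_code (fun p : 'I_N * tree (@ext_rank _ (@fo_rank tau k) N) =>
    nat_of_ord p.1 :: enc_tree (@enc_symbol tau k N) p.2).
  case=> [C t] [D u] x y /= [/ord_inj ->].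
  by move/(enc_tree_prefix_code (@enc_symbol_prefix_code tau k N)) => [-> ->].
rewrite -[flatten _]cats0 -[RHS]cats0.
by move/(flatten_prefix_code pe eq_szP) => [-> _].
Qed.

(** * Binary clocks *)

Definition binary (m : nat) (b : nat -> bool) : nat := \sum_(j < m) b j * 2 ^ j.

Lemma binaryS m b : binary m.+1 b = binary m b + b m * 2 ^ m.
Proof. by rewrite /binary big_ord_recr. Qed.

Lemma binary_lt m b : binary m b < 2 ^ m.
Proof.
elim: m => [|m IH]; first by rewrite /binary big_ord0.
by rewrite binaryS expnS; case: (b m); lia.
Qed.

Lemma eq_binary m b b' : (forall j, j < m -> b j = b' j) -> binary m b = binary m b'.
Proof. by move=> eq_b; apply: eq_bigr => j _; rewrite eq_b. Qed.

Lemma binary_inj m b b' : binary m b = binary m b' -> forall j, j < m -> b j = b' j.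
Proof.
elim: m => // m IH; rewrite !binaryS => eq_b.
have := binary_lt m b; have := binary_lt m b' => lt_b' lt_b.
have eq_m : b m = b' m by move: eq_b; case: (b m); case: (b' m); lia.
move: eq_b; rewrite eq_m => /addIn/IH eq_b j.
by rewrite ltnS leq_eqVlt => /predU1P[->|/eq_b].
Qed.

Lemma binary_low m l (b : nat -> bool) : l <= m -> (forall j, j < l -> b j) ->
  (forall j, l <= j -> j < m -> b j = false) -> binary m b = 2 ^ l - 1.
Proof.
move=> le_lm lo hi; elim: m le_lm hi => [|m IH] le_lm hi.
  by rewrite /binary big_ord0; move: le_lm; rewrite leqn0 => /eqP ->.
have Hfull k : k <= l -> binary k b = 2 ^ k - 1.
  elim: k => [|k IHk] lt_k; first by rewrite /binary big_ord0.
  by rewrite binaryS IHk ?(ltnW lt_k) // lo // expnS mul1n; have := expn_gt0 2 k; lia.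
move: le_lm; rewrite leq_eqVlt => /predU1P[<-|lt_lm]; first exact: Hfull.
rewrite binaryS IH //; last by move=> j le_j lt_j; apply: hi => //; lia.
by rewrite (hi m) ?addn0 //; lia.
Qed.

(* How bit [j] of a clock moves when bit [l] is the lowest one that is not set;
   the argument is the outcome of comparing [l] with [j]. [tick_load] requires
   all the bits above [l] to be clear and leaves the lower ones set. *)
Definition tick_next (r : comparison) (b : bool) : option bool :=
  match r with
  | Lt => Some b
  | Eq => if b then None else Some true
  | Gt => if b then Some false else None
  end.

Definition tick_load (r : comparison) (b : bool) : option bool :=
  match r with
  | Lt => if b then None else Some false
  | Eq => if b then None else Some true
  | Gt => if b then Some true else None
  end.

Definition bit_order (l j : nat) : comparison :=
  if l < j then Lt else if l == j then Eq else Gt.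

(** The bits below [l] drop from 2^l - 1 to 0 while bit [l] contributes 2^l: the balance is one. *)
Lemma tick_next_binary m l b b' : l < m ->
  (forall j, j < m -> tick_next (bit_order l j) (b j) = Some (b' j)) ->
  binary m b' = (binary m b).+1.
Proof.
move=> lt_lm tick.
have Hlo k : k <= l -> binary k b = 2 ^ k - 1 /\ binary k b' = 0.
  elim: k => [|k IH] lt_k; first by rewrite /binary !big_ord0.
  have [E E'] := IH (ltnW lt_k).
  have := tick k (ltn_trans lt_k lt_lm).
  rewrite !binaryS E E' /bit_order ltnNge (ltnW lt_k) /= gtn_eqF //.
  case: (b k) => //= -[<-]; rewrite expnS; have := expn_gt0 2 k; lia.
elim: m lt_lm tick => // m IH; rewrite ltnS leq_eqVlt => /predU1P[El|lt_lm] tick.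
  have [E E'] := Hlo l (leqnn l); have := tick m (leqnn _).
  rewrite !binaryS -El E E' /bit_order ltnn eqxx; case: (b l) => //= -[<-].
  by have := expn_gt0 2 l; lia.
rewrite !binaryS IH //; last by move=> j lt_j; apply: tick; apply: ltnW.
by have := tick m (leqnn _); rewrite /bit_order lt_lm /= => -[->].
Qed.

(** Both values are forced by [l], so the index of a [Fill] symbol tells the time to the automaton
    that does not see the clock. *)
Lemma tick_load_binary m l b b' : l < m ->
  (forall j, j < m -> tick_load (bit_order l j) (b j) = Some (b' j)) ->
  binary m b = 2 ^ l - 1 /\ binary m b' = 2 ^ l.+1 - 1.
Proof.
move=> lt_lm tick; split; apply: binary_low => //.
- exact: ltnW.
- move=> j lt_j; have := tick j (ltn_trans lt_j lt_lm).
  by rewrite /bit_order ltnNge (ltnW lt_j) /= gtn_eqF //; case: (b j).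
- move=> j le_j lt_j; have := tick j lt_j; rewrite /bit_order.
  by case: ltngtP le_j => //= _ _; case: (b j).
- move=> j lt_j; have := tick j (leq_trans lt_j lt_lm); rewrite /bit_order ltnNge -ltnS lt_j /=.
  by case: eqP => _; case: (b j) => // -[<-].
- move=> j lt_j lt_jm.
  by have := tick j lt_jm; rewrite /bit_order lt_j /=; case: (b j) => // -[<-].
Qed.

(** The lowest clear bit serves as [l]; without one the value would be 2^m - 1. *)
Lemma tick_next_exists m b : (binary m b).+1 < 2 ^ m -> exists l b',
  l < m /\ (forall j, j < m -> tick_next (bit_order l j) (b j) = Some (b' j)).
Proof.
move=> lt_b; have ex_l : exists l, (l < m) && ~~ b l.
  case: (boolP [forall j : 'I_m, b j]) => [/forallP all_b|].
    have : binary m b = 2 ^ m - 1.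
      apply: binary_low => [|j lt_j|j le_j]; first exact: leqnn.
        exact: (all_b (Ordinal lt_j)).
      by rewrite ltnNge le_j.
    by have := expn_gt0 2 m; lia.
  by rewrite negb_forall => /existsP[j nb]; exists j; rewrite ltn_ord.
case: (ex_minnP ex_l) => l /andP[lt_lm nbl] min_l.
exists l, (fun j => if l < j then b j else l == j); split=> // j lt_jm.
rewrite /bit_order; case: (ltngtP l j) => //= [lt_jl|<-]; last by rewrite (negPf nbl).
case Ebj : (b j) => //; have : l <= j by apply: min_l; rewrite lt_jm Ebj.
by rewrite leqNgt lt_jl.
Qed.

(** Time stamp of configuration [i]. The [n.+1] loading steps ([n] letters and the end marker) add
    one more low bit each; afterwards the clock counts by one. Only strict growth matters for
    identifying configurations. *)
Definition clock (n i : nat) : nat :=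
  if i <= n.+1 then 2 ^ i - 1 else 2 ^ n.+1 - 1 + (i - n.+1).

Lemma clock_lt n i : clock n i < clock n i.+1.
Proof.
rewrite /clock; case: (ltngtP i n.+1) => [lt_i|lt_i|->].
- by rewrite !expnS; have := expn_gt0 2 i; lia.
- by lia.
- by lia.
Qed.

Lemma clock_inj n : injective (clock n).
Proof.
have lt_clock i j : i < j -> clock n i < clock n j.
  elim: j => // j IH; rewrite ltnS leq_eqVlt => /predU1P[->|/IH lt_ij].
    exact: clock_lt.
  exact: ltn_trans lt_ij (clock_lt n j).
by move=> i j eq_ij; case: (ltngtP i j) => // /lt_clock; rewrite eq_ij ltnn.
Qed.

Lemma clock_load n i : i <= n.+1 -> clock n i = 2 ^ i - 1.
Proof. by rewrite /clock => ->. Qed.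

Lemma clock_next n i : n < i -> clock n i.+1 = (clock n i).+1.
Proof.
rewrite /clock => lt_ni; rewrite ltnS (leqNgt i n) lt_ni /=.
case: (leqP i n.+1) => [le_in|]; last by lia.
have -> : i = n.+1 by lia.
by rewrite subSnn addn1.
Qed.

Lemma leq_clock n i j : i <= j -> clock n i <= clock n j.
Proof.
elim: j => [|j IH]; first by rewrite leqn0 => /eqP ->.
rewrite leq_eqVlt => /predU1P[-> //|/IH le_ij].
exact: leq_trans le_ij (ltnW (clock_lt n j)).
Qed.

(** * Derivations simulating a stack machine *)

Inductive stack_op (A : Type) := Keep | Pop | Push of A.
Arguments Keep {A}.
Arguments Pop {A}.

(** [Bit] and [End] are what a [Fill] step reads while the input is loaded; a [Next] step reads
    [Run]. *)
Inductive signal := Run | Bit of bool | End.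

(* [Fill l] and [Next l] advance the clock, changing bit [l] from 0 to 1. *)
Inductive symbol (K : Type) :=
  | Init | Root of K | Join | Link | Self | Fill of nat | Next of nat.
Arguments Init {K}.
Arguments Join {K}.
Arguments Link {K}.
Arguments Self {K}.
Arguments Fill {K}.
Arguments Next {K}.

Inductive derivation (K : Type) :=
  Leaf | Branch of symbol K & derivation K & derivation K.
Arguments Leaf {K}.

(** The state holds bit [j] of both times of a fact, and [None] is the dead state. A tick requires
    both premises to have the same first time, advances it, and keeps the second time of the second
    premise. *)
Definition bit_rule (K : Type) (j : nat) (s : symbol K) (x y : option (bool * bool)) :
    option (bool * bool) :=
  let tick next := if (x, y) is (Some u, Some v) then
      if u.1 == v.1 then omap (fun b => (b, v.2)) (next u.1) else None
    else None in
  match s with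
  | Init | Root _ => Some (false, false)
  | Join => if (x, y) is (Some u, Some v) then
      if u.1 == v.1 then Some (u.1, v.2) else None else None
  | Link => if (x, y) is (Some u, Some v) then
      if u.2 == v.1 then Some (u.1, v.2) else None else None
  | Self => if x is Some u then Some (u.1, u.1) else None
  | Fill l => tick (tick_load (bit_order l j))
  | Next l => tick (tick_next (bit_order l j))
  end.

Fixpoint bit_value (K : Type) (j : nat) (d : derivation K) : option (bool * bool) :=
  match d with
  | Leaf => bit_rule (K := K) j Init None None
  | Branch s d1 d2 => bit_rule j s (bit_value j d1) (bit_value j d2)
  end.

Section Derivations.
Variables (K A C : finType) (blank : A).
Variables (op : C -> signal -> K -> stack_op A).
Variable next : C -> signal -> {ffun K -> A} -> C.
Variables (loading : pred C) (c0 : C).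

(* [acc c g]: the control state is [c] and [g] lists known tops of stacks;
   [top k a]: stack [k] is [a] followed by the stack [k] at the second time;
   [sub k a]: the same for stack [k] after removal of its top;
   [here k]: the two times are equal. *)
Definition fact : finType :=
  ((C * {ffun K -> option A} + K * A) + (K * A + K))%type.
Definition acc c g : fact := inl (inl (c, g)).
Definition top k a : fact := inl (inr (k, a)).
Definition sub k a : fact := inr (inl (k, a)).
Definition here k : fact := inr (inr k).

(** [x] supplies the control state, [y] what is carried to the next time: the control itself or one
    stack. A pop needs the entry below the top ([sub]); a push needs equal times ([here]), so that
    the present stack becomes the tail of the new one. Comparing [loading c] with the signal keeps
    [Fill] and [Next] to their phases. *)
Definition fact_step (s : signal) (x y : fact) : option fact :=
  if x is inl (inl (c, g)) then
    if loading c == (if s is Run then false else true) then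
      match y with
      | inl (inl _) =>
          if [forall k, g k != None]
          then Some (acc (next c s [ffun k => odflt blank (g k)]) [ffun=> None])
          else None
      | inl (inr (k, a)) => if op c s k is Keep then Some (top k a) else None
      | inr (inl (k, a)) => if op c s k is Pop then Some (top k a) else None
      | inr (inr k) => if op c s k is Push a then Some (top k a) else None
      end
    else None
  else None.

Definition fact_rule (input : nat -> signal) (s : symbol K) (x y : option fact) :
    option fact :=
  match s with
  | Init => Some (acc c0 [ffun=> None])
  | Root k => Some (top k blank)
  | Join =>
      if (x, y) is (Some (inl (inl (c, g))), Some (inl (inr (k, a)))) then
        Some (acc c [ffun i => if i == k then Some a else g i]) else None
  | Link =>
      if (x, y) is (Some (inl (inr (k, _))), Some (inl (inr (k', b)))) then
        if k == k' then Some (sub k b) else None else None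
  | Self => if x is Some (inl (inr (k, _))) then Some (here k) else None
  | Fill l => if (x, y) is (Some u, Some v) then fact_step (input l) u v else None
  | Next _ => if (x, y) is (Some u, Some v) then fact_step Run u v else None
  end.

Variable input : nat -> signal.

Fixpoint fact_value (d : derivation K) : option fact :=
  match d with
  | Leaf => fact_rule input Init None None
  | Branch s d1 d2 => fact_rule input s (fact_value d1) (fact_value d2)
  end.

Variable m : nat.

Definition valid_symbol (s : symbol K) : bool :=
  match s with Init => false | Fill l | Next l => l < m | _ => true end.

Fixpoint valid (d : derivation K) : bool :=
  match d with
  | Leaf => true
  | Branch s d1 d2 => [&& valid_symbol s, valid d1 & valid d2]
  end.

Definition derives (d : derivation K) (x : fact) (t u : nat -> bool) : Prop :=
  fact_value d = Some x /\ forall j, j < m -> bit_value j d = Some (t j, u j).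

Variable n : nat.
Variables (ctl : nat -> C) (stk : nat -> K -> seq A).
Definition sgn (i : nat) : signal := if i <= n then input i else Run.
Hypothesis input_not_run : forall i, input i <> Run.
Hypothesis ctl0 : ctl 0 = c0.
Hypothesis stk0 : forall k, stk 0 k = [::].
Hypothesis ctlS : forall i,
  ctl i.+1 = next (ctl i) (sgn i) [ffun k => head blank (stk i k)].
Hypothesis stkS : forall i k, stk i.+1 k =
  match op (ctl i) (sgn i) k with
  | Keep => stk i k
  | Pop => behead (stk i k)
  | Push a => a :: stk i k
  end.
Hypothesis ctl_loading : forall i, loading (ctl i) = (i <= n).

(** Meaning of a fact in the abstract run, used as the soundness invariant. The second time of an
    [acc] fact is unconstrained. *)
Definition true_fact (x : fact) (t u : nat) : Prop :=
  match x with
  | inl (inl (c, g)) => exists i, [/\ t = clock n i, c = ctl i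
      & forall k a, g k = Some a -> a = head blank (stk i k)]
  | inl (inr (k, a)) => exists i i', [/\ t = clock n i, u = clock n i',
      a = head blank (stk i k) & stk i' k = behead (stk i k)]
  | inr (inl (k, a)) => exists i i', [/\ t = clock n i, u = clock n i',
      a = head blank (behead (stk i k)) & stk i' k = behead (behead (stk i k))]
  | inr (inr k) => exists2 i, t = clock n i & u = clock n i
  end.

(** Equal stamps force both premises to describe the same configuration [i], by injectivity of
    [clock]; the equations of the run then give configuration [i.+1]. *)
Lemma true_fact_step s x y t u t' i :
    t = clock n i -> true_fact x t u -> true_fact y t t' ->
    forall z t1, t1 = clock n i.+1 -> s = sgn i -> fact_step s x y = Some z ->
  true_fact z t1 t'.
Proof.
move=> -> {t}; rewrite /fact_step; case: x => [[[c g]|[]]|] //=.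
case=> j [/clock_inj <- {j} -> Hg] Hy z _ -> ->; case: ifP => // _.
case: y Hy => [[[c' g']|[k a]]|[[k a]|k]] /=.
- move=> _; case: ifP => // /forallP Hall [<-] /=; exists i.+1; split=> //.
    rewrite ctlS; congr next; apply/ffunP => k; rewrite !ffunE.
    by have := Hall k; case E : (g k) => [a|] //= _; apply: Hg.
  by move=> k a; rewrite ffunE.
- case=> j [j' [/clock_inj <- -> -> Ej']]; case E : op => // -[<-] /=.
  by exists i.+1, j'; rewrite stkS E.
- case=> j [j' [/clock_inj <- -> -> Ej']]; case E : op => // -[<-] /=.
  by exists i.+1, j'; rewrite stkS E.
- case=> j /clock_inj <- ->; case E : op => [||a] // -[<-] /=.
  by exists i.+1, i; rewrite stkS E.
Qed.

Lemma binary_false b : (forall j, j < m -> b j = false) -> binary m b = clock n 0.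
Proof. by move=> b0; rewrite (@binary_low _ 0) // => j _; apply: b0. Qed.

Lemma derives_true d x t u : valid d -> derives d x t u ->
  true_fact x (binary m t) (binary m u).
Proof.
elim: d x t u => [|s d1 IH1 d2 IH2] x t u /=.
  move=> _ [[<-] bits]; exists 0; rewrite ctl0; split=> // [|k a].
    by apply: binary_false => j /bits [].
  by rewrite ffunE.
move=> /and3P[val_s val1 val2] [].
(* The default pair is harmless: wherever these bits are used, the bit automata are first shown to
   be alive on the premise. *)
pose t1 j := (odflt (false, false) (bit_value j d1)).1.
pose u1 j := (odflt (false, false) (bit_value j d1)).2.
pose t2 j := (odflt (false, false) (bit_value j d2)).1.
pose u2 j := (odflt (false, false) (bit_value j d2)).2.
have {}IH1 y : fact_value d1 = Some y -> (forall j, j < m -> bit_value j d1) ->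
    true_fact y (binary m t1) (binary m u1).
  move=> Ey bits; apply: IH1 => //; split=> // j /bits.
  by rewrite /t1 /u1; case: bit_value => [[]|].
have {}IH2 y : fact_value d2 = Some y -> (forall j, j < m -> bit_value j d2) ->
    true_fact y (binary m t2) (binary m u2).
  move=> Ey bits; apply: IH2 => //; split=> // j /bits.
  by rewrite /t2 /u2; case: bit_value => [[]|].
have tickP (r : comparison -> bool -> option bool) l :
    (forall j, j < m -> (if (bit_value j d1, bit_value j d2) is (Some a, Some b) then
       if a.1 == b.1 then omap (fun c => (c, b.2)) (r (bit_order l j) a.1) else None
     else None) = Some (t j, u j)) ->
    [/\ (forall j, j < m -> bit_value j d1), (forall j, j < m -> bit_value j d2),
       binary m t2 = binary m t1, binary m u = binary m u2 &
       (forall j, j < m -> r (bit_order l j) (t1 j) = Some (t j))].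
  move=> bits; split; [move=> j|move=> j|apply: eq_binary => j|apply: eq_binary => j|move=> j] => /bits;
    rewrite /t1 /u1 /t2 /u2; case: (bit_value j d1) => // a; case: (bit_value j d2) => // b;
    case: eqP => //=; case: (r _ _) => //= c ? [] *; congruence.
case: s val_s => [|k||||l|l] /= val_s.
- by [].
- case=> <- bits; exists 0, 0; rewrite stk0; split=> //;
  by apply: binary_false => j /bits [].
- case E1 : (fact_value d1) => [[[[c g]|]|]|] //; case E2 : (fact_value d2) => [[[|[k a]]|]|] // [<-] bits.
  have alive1 j : j < m -> bit_value j d1 by move=> /bits; case: (bit_value j d1).
  have alive2 j : j < m -> bit_value j d2.
    by move=> /bits; case: (bit_value j d1) => // ?; case: (bit_value j d2).
  have [i [Et Ec Hg]] := IH1 _ E1 alive1.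
  have [i' [i2 [Et2 _ Ea _]]] := IH2 _ E2 alive2.
  have eq_t : binary m t1 = binary m t2 /\ binary m t = binary m t1.
    split; apply: eq_binary => j /bits; rewrite /t1 /t2;
    case: (bit_value j d1) => // y; case: (bit_value j d2) => // z; case: eqP => //= ? [] *; congruence.
  case: eq_t => eq12 ->.
  have Ei : i = i' by apply: (@clock_inj n); rewrite -Et -Et2.
  exists i; split=> // k' a'; rewrite ffunE; case: eqP => [-> [<-]|_ /Hg //].
  by rewrite Ei.
- case E1 : (fact_value d1) => [[[|[k a]]|]|] //.
  case E2 : (fact_value d2) => [[[|[k' b]]|]|] //; case: eqP => // Ek [<-] bits.
  rewrite -{}Ek in E2.
  have alive1 j : j < m -> bit_value j d1 by move=> /bits; case: (bit_value j d1).
  have alive2 j : j < m -> bit_value j d2.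
    by move=> /bits; case: (bit_value j d1) => // ?; case: (bit_value j d2).
  have [i [i' [Et Eu _ Ei']]] := IH1 _ E1 alive1.
  have [i1 [i2 [Et2 Eu2 Eb Ei2]]] := IH2 _ E2 alive2.
  have [eq1 eq2 eq3] : [/\ binary m u1 = binary m t2, binary m t = binary m t1 &
      binary m u = binary m u2].
    split; apply: eq_binary => j /bits; rewrite /t1 /t2 /u1 /u2;
    case: (bit_value j d1) => // y; case: (bit_value j d2) => // z; case: eqP => //= ? [] *; congruence.
  move: Et2; rewrite -eq1 Eu => /clock_inj E; exists i, i2.
  by rewrite eq2 eq3 -Ei' E.
- case E1 : (fact_value d1) => [[[|[k a]]|]|] // [<-] bits.
  have alive1 j : j < m -> bit_value j d1 by move=> /bits; case: (bit_value j d1).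
  have [i [i' [Et Eu _ Ei']]] := IH1 _ E1 alive1.
  by exists i; rewrite -Et; apply: eq_binary => j /bits; rewrite /t1;
    case: (bit_value j d1) => //= y [].
- case E1 : (fact_value d1) => [y|] //; case E2 : (fact_value d2) => [z|] // step bits.
  have [alive1 alive2 eq12 -> tick] := tickP _ _ bits.
  have [Et1 Et] := tick_load_binary val_s tick.
  have Hy := IH1 _ E1 alive1; have Hz := IH2 _ E2 alive2; rewrite eq12 in Hz.
  have [i Ei load_i] : exists2 i, binary m t1 = clock n i & i <= n.
    move: step Hy; rewrite /fact_step; case: y {E1} => [[[c g]|]|] //=.
    case: ifP => // load _ [i [Et1' Ec _]]; exists i => //.
    move: load; rewrite Ec ctl_loading; have := @input_not_run l.
    by case: (input l) => // [_ _ /eqP|_ /eqP].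
  (* [Fill l] fires only at stamp 2^l - 1, and a configuration of the loading phase has stamp 2^i -
     1; hence the letter read is the one for step [i]. *)
  have El : i = l.
    apply/eqP; rewrite -(eqn_exp2l _ _ (isT : 1 < 2)); move: Ei; rewrite Et1 clock_load ?leqW //.
    by have := expn_gt0 2 i; have := expn_gt0 2 l; lia.
  apply: (true_fact_step Ei Hy Hz _ _ step).
    by rewrite Et clock_load El // ltnS -El.
  by rewrite /sgn load_i El.
- case E1 : (fact_value d1) => [y|] //; case E2 : (fact_value d2) => [z|] // step bits.
  have [alive1 alive2 eq12 -> tick] := tickP _ _ bits.
  have Et := tick_next_binary val_s tick.
  have Hy := IH1 _ E1 alive1; have Hz := IH2 _ E2 alive2; rewrite eq12 in Hz.
  have [i Ei load_i] : exists2 i, binary m t1 = clock n i & n < i.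
    move: step Hy; rewrite /fact_step; case: y {E1} => [[[c g]|]|] //=.
    case: ifP => // load _ [i [Et1' Ec _]]; exists i => //.
    by move: load; rewrite Ec ctl_loading ltnNge; case: (i <= n).
  apply: (true_fact_step Ei Hy Hz _ _ step); first by rewrite Et Ei clock_next.
  by rewrite /sgn leqNgt load_i.
Qed.

Definition derivable (x : fact) (T U : nat) : Prop :=
  exists d t u, [/\ valid d, derives d x t u, binary m t = T & binary m u = U].

Lemma derivable_join c g k a T U U' :
  derivable (acc c g) T U -> derivable (top k a) T U' ->
  derivable (acc c [ffun i => if i == k then Some a else g i]) T U'.
Proof.
case=> d1 [t1 [u1 [v1 [E1 b1] <- _]]] [d2 [t2 [u2 [v2 [E2 b2] /binary_inj eq_t <-]]]].
exists (Branch Join d1 d2), t1, u2; split=> //=; first by rewrite v1.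
by split=> [|j lt_j]; rewrite /= ?E1 ?E2 // b1 // b2 //= eq_t // eqxx.
Qed.

Lemma derivable_link k a b T U V :
  derivable (top k a) T U -> derivable (top k b) U V -> derivable (sub k b) T V.
Proof.
case=> d1 [t1 [u1 [v1 [E1 b1] <- <-]]] [d2 [t2 [u2 [v2 [E2 b2] /binary_inj eq_t <-]]]].
exists (Branch Link d1 d2), t1, u2; split=> //=; first by rewrite v1.
by split=> [|j lt_j]; rewrite /= ?E1 ?E2 /= ?eqxx // b1 // b2 //= eq_t // eqxx.
Qed.

Lemma derivable_self k a T U : derivable (top k a) T U -> derivable (here k) T T.
Proof.
case=> d1 [t1 [u1 [v1 [E1 b1] <- _]]].
exists (Branch Self d1 d1), t1, t1; split=> //=; first by rewrite v1.
by split=> [|j lt_j]; rewrite /= ?E1 // b1.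
Qed.

Lemma derivable_step i x y z U U' : clock n i.+1 < 2 ^ m ->
  derivable x (clock n i) U -> derivable y (clock n i) U' ->
  fact_step (sgn i) x y = Some z -> derivable z (clock n i.+1) U'.
Proof.
move=> lt_i [d1 [t1 [u1 [v1 [E1 b1] Et1 _]]]].
case=> [d2 [t2 [u2 [v2 [E2 b2] Et2 <-]]]] step.
have eq_t : forall j, j < m -> t1 j = t2 j by apply: binary_inj; rewrite Et1.
case: (leqP i n) => [le_in|lt_ni].
  (* The next stamp is 2^(i+1) - 1 and fits into [m] bits, so [Fill i] is available. *)
  have lt_im : i < m.
    rewrite -(ltn_exp2l i m (isT : 1 < 2)); move: lt_i; rewrite clock_load //.
    by rewrite expnS; have := expn_gt0 2 i; lia.
  have [Et1' tick] : binary m (fun j => j < i) = 2 ^ i - 1 /\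
      binary m (fun j => j < i.+1) = 2 ^ i.+1 - 1.
    split; apply: binary_low => //; try exact: ltnW.
    - by move=> j le_j _; rewrite ltnNge le_j.
    - by move=> j le_j _; rewrite ltnNge le_j.
  (* By uniqueness of binary notation the stamp 2^i - 1 has exactly the bits below [i] set, as
     [tick_load] demands. *)
  have Et j : j < m -> t1 j = (j < i).
    by apply: (@binary_inj m t1 (fun j => j < i)); rewrite Et1 Et1' clock_load // ltnW.
  exists (Branch (Fill i) d1 d2), (fun j => j < i.+1), u2; split=> //=.
  - by rewrite lt_im v1.
  - split=> [|j lt_j]; rewrite /= ?E1 ?E2; first by move: step; rewrite /sgn le_in.
    rewrite b1 // b2 //= eq_t // eqxx -eq_t // Et // /bit_order /tick_load ltnS.
    by case: ltngtP.
  - by rewrite tick clock_load.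
have [|l [b [lt_lm tick]]] := @tick_next_exists m t1.
  by rewrite Et1 -clock_next.
exists (Branch (Next l) d1 d2), b, u2; split=> //=.
- by rewrite lt_lm v1.
- split=> [|j lt_j]; rewrite /= ?E1 ?E2.
    by move: step; rewrite /sgn leqNgt lt_ni.
  by rewrite b1 // b2 //= eq_t // eqxx -eq_t // tick.
- by rewrite (tick_next_binary lt_lm tick) Et1 clock_next.
Qed.

(** The bound [i' <= i] is what allows a pop to invoke the induction hypothesis at the time of the
    tail. *)
Definition reached (i : nat) : Prop :=
  (exists U, derivable (acc (ctl i) [ffun=> None]) (clock n i) U) /\
  forall k, exists i', [/\ i' <= i, stk i' k = behead (stk i k)
    & derivable (top k (head blank (stk i k))) (clock n i) (clock n i')].

(** [Root k] describes an empty stack as a blank on top of itself at time 0; this agrees with [head]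
    and [behead] on the empty list and makes popping an empty stack harmless. *)
Lemma reached0 : reached 0.
Proof.
have bin0 : binary m (fun=> false) = clock n 0 by apply: binary_false.
split=> [|k].
  by exists (clock n 0), Leaf, (fun=> false), (fun=> false); split=> //; split; rewrite /= ?ctl0.
exists 0; rewrite stk0; split=> //.
by exists (Branch (Root k) Leaf Leaf), (fun=> false), (fun=> false).
Qed.

Lemma derivable_tops i : reached i -> exists U,
  derivable (acc (ctl i) [ffun k => Some (head blank (stk i k))]) (clock n i) U.
Proof.
case=> -[U0 acc0] tops.
(* Tops are collected one stack at a time. Each [Join] takes over the second time of the stack fact,
   hence the existential [U]. *)
suff [U HU] : exists U, derivable (acc (ctl i)
    [ffun k => if k \in enum K then Some (head blank (stk i k)) else None]) (clock n i) U.
  exists U; move: HU; congr derivable; congr acc; apply/ffunP => k.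
  by rewrite !ffunE mem_enum.
elim: (enum K) => [|k l [U IH]].
  by exists U0; move: acc0; congr derivable; congr acc; apply/ffunP => k; rewrite !ffunE.
have [i' [_ _ top_k]] := tops k; exists (clock n i').
have := derivable_join IH top_k; congr derivable; congr acc; apply/ffunP => k'.
by rewrite !ffunE inE; case: eqP => // ->.
Qed.

(** Strong induction: after a pop the new top is found by linking to the description of the tail at
    an earlier time. *)
Lemma reachedP i : clock n i < 2 ^ m -> reached i.
Proof.
elim/ltn_ind: i => -[|i] IH lt_i; first exact: reached0.
have lt_clock j : j <= i -> clock n j < 2 ^ m.
  by move=> le_ji; apply: leq_ltn_trans lt_i; apply: leq_clock; apply: leqW.
have Hi : reached i by apply: IH => //; apply: lt_clock.
have [U full] := derivable_tops Hi.
have load_i : loading (ctl i) = (if sgn i is Run then false else true).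
  rewrite ctl_loading /sgn; case: (i <= n) => //.
  by have := @input_not_run i; case: (input i).
have [_ tops] := Hi; split=> [|k].
  exists U; apply: (derivable_step lt_i full full).
  rewrite /fact_step /acc load_i eqxx ifT; last by apply/forallP => k; rewrite ffunE.
  congr (Some (acc _ _)); rewrite ctlS; congr next; apply/ffunP => k.
  by rewrite !ffunE.
have [i' [le_i' Ei' top_k]] := tops k.
rewrite stkS; case Eop : (op _ _ _) => [||a].
- exists i'; split=> //; first exact: leqW.
  apply: (derivable_step lt_i full top_k).
  by rewrite /fact_step /acc /top load_i eqxx Eop.
- have [_ /(_ k) [i2 [le_i2 Ei2 top_k2]]] : reached i'.
    by apply: IH => //; apply: lt_clock.
  exists i2; rewrite -Ei'; split=> //; first by apply: leqW; apply: leq_trans le_i2 le_i'.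
  apply: (derivable_step lt_i full (derivable_link top_k top_k2)).
  by rewrite /fact_step /acc /top /sub load_i eqxx Eop.
- exists i; split=> //.
  apply: (derivable_step lt_i full (derivable_self top_k)).
  by rewrite /fact_step /acc /here load_i eqxx Eop.
Qed.

Lemma derivesP (P : pred C) :
  (exists d c g t u, [/\ valid d, derives d (acc c g) t u & P c]) <->
  (exists2 i, clock n i < 2 ^ m & P (ctl i)).
Proof.
split=> [[d [c [g [t [u [val der Pc]]]]]]|[i /reachedP [[U [d [t [u [val der _ _]]]]] _] Pc]].
  have [i [Et Ec _]] := derives_true val der.
  by exists i; rewrite -?Ec // -Et binary_lt.
by exists d, (ctl i), [ffun=> None], t, u.
Qed.

End Derivations.

(** * Structures as deterministic bottom-up tree automata *)

Lemma nth_map_enum n (T : Type) (x0 : T) (F : 'I_n -> T) j (lt_jn : j < n) :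
  nth x0 [seq F i | i <- enum 'I_n] j = F (Ordinal lt_jn).
Proof.
rewrite (nth_map (Ordinal lt_jn)) ?size_enum_ord //; congr F.
by apply: val_inj; rewrite /= nth_enum_ord.
Qed.

Section Automata.
Variables (K Y : finType).

(** Element 0 is the dead state. Being also the default of [nth], it makes a missing argument of a
    nullary symbol read as [None]. *)
Definition to_dom (y : option Y) : 'I_#|Y|.+1 :=
  if y is Some y' then lift ord0 (enum_rank y') else ord0.

Definition of_dom (i : 'I_#|Y|.+1) : option Y := omap enum_val (unlift ord0 i).

Lemma to_domK : cancel to_dom of_dom.
Proof.
by case=> [y|]; rewrite /of_dom /to_dom ?liftK ?unlift_none //= enum_rankK.
Qed.

Variables (rule : symbol K -> option Y -> option Y -> option Y) (final : pred Y).

Fixpoint eval (d : derivation K) : option Y :=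
  match d with
  | Leaf => rule Init None None
  | Branch s d1 d2 => rule s (eval d1) (eval d2)
  end.

(** All symbols but one are binary, even those whose rule ignores an argument; this keeps the arity
    list and the grammar uniform and matches the binary [Branch]. *)
Definition arity (s : symbol K) : nat := if s is Init then 0 else 2.

Definition automaton_sig (syms : seq (symbol K)) : signature :=
  Signature [:: 1] (map arity syms).

Definition apply_rule (s : symbol K) (t : seq 'I_#|Y|.+1) : 'I_#|Y|.+1 :=
  to_dom (rule s (of_dom (nth ord0 t 0)) (of_dom (nth ord0 t 1))).

Definition is_final (t : seq 'I_#|Y|.+1) : bool :=
  if of_dom (nth ord0 t 0) is Some y then final y else false.

Definition automaton (syms : seq (symbol K)) : structure (automaton_sig syms) :=
  @Structure (automaton_sig syms) #|Y|
    (fun R => [set t : (rel_ar R).-tuple 'I_#|Y|.+1 | is_final t])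
    (fun f => [ffun t : (fun_ar f).-tuple 'I_#|Y|.+1 => apply_rule (nth Init syms f) t]).

End Automata.

Section Terms.
Variables (K : finType) (k : nat) (syms : seq (symbol K)).
Notation tau := (automaton_sig syms).

Lemma fun_arE (f : fun_symbol tau) : fun_ar f = arity (nth Init syms f).
Proof. by rewrite /fun_ar (nth_map Init) //; case: f => f; rewrite /= size_map. Qed.

Fixpoint ground (t : term tau k) : Prop :=
  match t with App f ts => forall i, ground (ts i) | _ => False end.

Fixpoint derivation_of (t : term tau k) : derivation K :=
  match t with
  | App f ts =>
      let l := [seq derivation_of (ts i) | i <- enum 'I_(fun_ar f)] in
      let s := nth Init syms f in
      if s is Init then Leaf else Branch s (nth Leaf l 0) (nth Leaf l 1)
  | _ => Leaf
  end.

Lemma value_ground (Y : finType) (rule : symbol K -> option Y -> option Y -> option Y)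
    (final : pred Y) (e : 'I_k -> dom (automaton rule final syms)) t :
  ground t -> of_dom (value e t) = eval rule (derivation_of t).
Proof.
elim: t => // f ts IH gr /=.
have {}IH i := IH i (gr i); rewrite ffunE /apply_rule to_domK /=.
have args j : of_dom (nth ord0 [seq value e (ts i) | i <- enum 'I_(fun_ar f)] j) =
    if j < arity (nth Init syms f) then
      eval rule (nth Leaf [seq derivation_of (ts i) | i <- enum 'I_(fun_ar f)] j)
    else None.
  rewrite -fun_arE; case: ltnP => [lt_j|le_j]; first by rewrite !nth_map_enum.
  by rewrite nth_default ?(to_domK None) // size_map size_enum_ord.
rewrite !args.
by case: (nth _ _ _).
Qed.

Lemma nth_map_two (T : Type) (x0 : T) n (F : 'I_n -> T) a b : n = 2 ->
  (forall i : 'I_n, F i = if i == 0 :> nat then a else b) ->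
  nth x0 [seq F i | i <- enum 'I_n] 0 = a /\ nth x0 [seq F i | i <- enum 'I_n] 1 = b.
Proof.
move=> n2 EF; have lt0 : 0 < n by rewrite n2.
have lt1 : 1 < n by rewrite n2.
by rewrite !nth_map_enum !EF.
Qed.

Lemma derivation_of_surj m d :
  (forall s, valid_symbol m s -> exists2 i, i < size syms & nth Init syms i = s) ->
  (exists2 i, i < size syms & nth Init syms i = Init) ->
  valid m d -> exists2 t : term tau k, ground t & derivation_of t = d.
Proof.
move=> mem_sym [i0 lt_i0 Ei0]; elim: d => [_|s d1 IH1 d2 IH2 /and3P[vs /IH1[t1 g1 E1] /IH2[t2 g2 E2]]].
  have lt_i : i0 < size (fun_arities tau) by rewrite size_map.
  have ar0 : fun_ar (Ordinal lt_i : fun_symbol tau) = 0 by rewrite fun_arE /= Ei0.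
  have no_arg : 'I_(fun_ar (Ordinal lt_i : fun_symbol tau)) -> False by rewrite ar0 => -[].
  exists (@App tau k (Ordinal lt_i) (fun i => False_rect _ (no_arg i))).
    by move=> i; case: (no_arg i).
  by rewrite /= Ei0.
have ne_s : s <> Init by case: (s) vs.
have [i lt_i Ei] := mem_sym s vs.
have {}lt_i : i < size (fun_arities tau) by rewrite size_map.
have ar2 : fun_ar (Ordinal lt_i : fun_symbol tau) = 2.
  by rewrite fun_arE /= Ei; case: (s) ne_s.
exists (@App tau k (Ordinal lt_i) (fun i => if i == 0 :> nat then t1 else t2)).
  by move=> j /=; case: (_ == _).
pose F (i : 'I_(fun_ar (Ordinal lt_i : fun_symbol tau))) :=
  derivation_of (if i == 0 :> nat then t1 else t2).
have EF i' : F i' = if i' == 0 :> nat then d1 else d2 by rewrite /F; case: (_ == _).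
have [/= E0 E1'] := nth_map_two Leaf ar2 EF.
by rewrite /= -/F E0 E1' Ei; case: (s) ne_s.
Qed.

End Terms.

Section ClosRewrites.
Variables (S : Type) (rank : S -> nat) (G : grammar rank).
Notation derives := (clos_refl_trans _ (@rewrites S rank G)).

Lemma derives_child (s : S + 'I_(nonterminals G))
    (ts : 'I_(@ext_rank S rank _ s) -> tree (@ext_rank S rank (nonterminals G))) i t t' :
  derives t t' ->
  derives (@Node _ _ s (fun j => if j == i then t else ts j))
          (@Node _ _ s (fun j => if j == i then t' else ts j)).
Proof.
elim=> {t t'} [t t' step|t|t t1 t' _ IH1 _ IH2].
- apply: rt_step; apply: (rewrite_child (i := i)); first by rewrite !eqxx.
  by move=> j /negPf ->.
- exact: rt_refl.
- exact: rt_trans IH1 IH2.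
Qed.

(** The children are rewritten one at a time along an enumeration, through families that agree with
    [ts'] on the indices treated so far and with [ts] elsewhere. *)
Lemma derives_children (s : S + 'I_(nonterminals G))
    (ts ts' : 'I_(@ext_rank S rank _ s) -> tree (@ext_rank S rank (nonterminals G))) :
  (forall i, derives (ts i) (ts' i)) -> derives (@Node _ _ s ts) (@Node _ _ s ts').
Proof.
move=> der.
have -> : ts' = fun j => if j \in enum 'I_(@ext_rank S rank _ s) then ts' j else ts j.
  by apply: functional_extensionality => j; rewrite mem_enum.
elim: (enum _) => [|i l IH]; first exact: rt_refl.
apply: rt_trans IH _.
pose u j := if j \in l then ts' j else ts j.
have [i_l|i_l] := boolP (i \in l).
  set v := (X in derives _ (Node X)).
  suff -> : v = u by exact: rt_refl.
  apply: functional_extensionality => j; rewrite /v /u inE.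
  by case: eqP => // ->; rewrite i_l.
have := derives_child u i (der i); congr derives; congr Node;
  apply: functional_extensionality => j; rewrite /u ?inE.
  by case: eqP => // ->; rewrite (negPf i_l).
by case: eqP => // ->.
Qed.

End ClosRewrites.

(** * The regular grammar of acceptance atoms over ground terms *)

Section GroundGrammar.
Variables (K : finType) (k : nat) (syms : seq (symbol K)).
Notation tau := (automaton_sig syms).
Notation xtree := (tree (@ext_rank (fo_symbol tau k) (@fo_rank tau k) 2)).

Definition final_symbol : rel_symbol tau := @ord0 0.

Lemma final_symbolE (R : rel_symbol tau) : R = final_symbol.
Proof. by apply: ord_inj; case: R => -[]. Qed.

Definition n_formula : 'I_2 := ord0.
Definition n_term : 'I_2 := ord_max.

Definition symbol_tree (s : fo_symbol tau k) : xtree :=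
  @Node _ (@ext_rank _ (@fo_rank tau k) 2) (inl s) (fun=> leaf (@fo_rank tau k) n_term).

Definition ground_grammar : fo_grammar tau k :=
  @Grammar _ (@fo_rank tau k) 2 n_formula
    ((n_formula, symbol_tree (SRel final_symbol)) ::
     [seq (n_term, symbol_tree (SFun f)) | f <- enum (fun_symbol tau)]).

(** Invariant of sentential forms: it admits trees that still contain [n_term], so that each single
    rewriting step preserves it. *)
Fixpoint term_form (t : xtree) : Prop :=
  match t with
  | Node s ts =>
      match s with inl (SFun _) => True | inr B => B = n_term | _ => False end /\
      forall i, term_form (ts i)
  end.

Definition formula_form (t : xtree) : Prop :=
  match t with
  | Node s ts =>
      match s with inl (SRel _) => True | inr B => B = n_formula | _ => False end /\
      forall i, term_form (ts i)
  end.

Lemma In_map (T : eqType) (U : Type) (f : T -> U) (l : seq T) y :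
  List.In y (map f l) <-> exists2 x, x \in l & y = f x.
Proof.
elim: l => [|a l IH] /=; first by split=> // -[].
split=> [[<-|/IH[x xl ->]]|[x]].
- by exists a; rewrite ?mem_head.
- by exists x; rewrite ?inE ?xl ?orbT.
- rewrite inE => /predU1P[-> ->|xl Ey]; first by left.
  by right; apply/IH; exists x.
Qed.

Lemma rule_cases B t : List.In (B, t) (rules ground_grammar) ->
  (B = n_formula /\ t = symbol_tree (SRel final_symbol)) \/
  (B = n_term /\ exists f, t = symbol_tree (SFun f)).
Proof.
case=> [[<- <-]|/In_map[f _ [-> ->]]]; [by left|by right; split=> //; exists f].
Qed.

Lemma term_form_rewrites (t t' : xtree) :
  @rewrites _ _ ground_grammar t t' -> term_form t -> term_form t'.
Proof.
elim=> {t t'} [B t /rule_cases[[-> _]|[_ [f ->]]]|s ts ts' i _ IH eq_ts] /=.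
- by case=> /(congr1 val).
- by move=> _; split=> // i; split=> // -[].
- case=> Hs Hts; split=> // j; case: (eqVneq j i) => [->|/eq_ts ->]; last exact: Hts.
  exact: IH.
Qed.

Lemma formula_form_rewrites (t t' : xtree) :
  @rewrites _ _ ground_grammar t t' -> formula_form t -> formula_form t'.
Proof.
case=> {t t'} [B t /rule_cases[[_ ->]|[-> _]]|s ts ts' i step eq_ts] /=.
- by move=> _; split=> // i; split=> // -[].
- by case=> /(congr1 val).
- case=> Hs Hts; split=> // j; case: (eqVneq j i) => [->|/eq_ts ->]; last exact: Hts.
  exact: term_form_rewrites step (Hts i).
Qed.

Lemma ground_term_form (t : term tau k) :
  term_form (embed 2 (tree_of_term t)) -> ground t.
Proof. by elim: t => [x|f ts IH|phi t1 _ t2 _] /= [] // _ H i; apply: IH. Qed.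

Lemma generated_ground (phi : formula tau k) :
  generated ground_grammar (tree_of_formula phi) ->
  exists R (ts : 'I_(rel_ar R) -> term tau k), phi = Atom ts /\ forall i, ground (ts i).
Proof.
rewrite /generated => gen.
have : formula_form (embed 2 (tree_of_formula phi)).
  have : formula_form (leaf (@fo_rank tau k) n_formula) by split=> // -[].
  elim: gen => [t t'|t|t t1 t' _ IH1 _ IH2]; [exact: formula_form_rewrites|by []|].
  by move/IH1/IH2.
case: phi {gen} => [R ts|p q|p q|p|x p|x p] /= [] // _ gr.
by exists R, ts; split=> // i; apply: ground_term_form; apply: gr.
Qed.

Notation grammar_derives := (clos_refl_trans _ (@rewrites _ _ ground_grammar)).

Lemma ground_derives (t : term tau k) : ground t ->
  grammar_derives (leaf (@fo_rank tau k) n_term) (embed 2 (tree_of_term t)).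
Proof.
elim: t => // f ts IH gr.
apply: (@rt_trans _ _ _ (symbol_tree (SFun f))).
  apply: rt_step; apply: (@rewrite_rule _ _ ground_grammar).
  by right; apply/In_map; exists f; rewrite ?mem_enum.
by apply: (derives_children (G := ground_grammar)) => i; apply: IH; apply: gr.
Qed.

Lemma ground_generated R (ts : 'I_(rel_ar R) -> term tau k) :
  (forall i, ground (ts i)) ->
  generated ground_grammar (tree_of_formula (Atom ts)).
Proof.
move=> gr; rewrite /generated.
apply: (@rt_trans _ _ _ (symbol_tree (SRel R))).
  by apply: rt_step; apply: (@rewrite_rule _ _ ground_grammar); left; rewrite [R]final_symbolE.
by apply: (derives_children (G := ground_grammar)) => i; apply: ground_derives.
Qed.

Lemma ground_fv (t : term tau k) : ground t -> term_fv t = set0.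
Proof.
by elim: t => // f ts IH gr /=; apply: big1 => i _; apply: IH.
Qed.

End GroundGrammar.

Section Acceptance.
Variables (K Y : finType) (k : nat) (syms : seq (symbol K)).
Variables (rule : symbol K -> option Y -> option Y -> option Y) (final : pred Y).
Notation tau := (automaton_sig syms).

Definition accepts (d : derivation K) : bool :=
  if eval rule d is Some y then final y else false.

Definition the_arg : 'I_(rel_ar (final_symbol syms)) := @ord0 0.

(** With no free variable the only candidate answer is the empty tuple, so demanding the full answer
    set demands that the sentence hold. *)
Lemma answers_atom (ts : 'I_(rel_ar (final_symbol syms)) -> term tau k) :
  (forall i, ground (ts i)) ->
  answers 0 (automaton rule final syms) (Atom ts) = setT <->
  accepts (derivation_of (ts the_arg)).
Proof.
move=> gr; set e0 := fun x : 'I_k => nth ord0 ([tuple] : 0.-tuple (dom (automaton rule final syms))) x.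
have E : holds e0 (Atom ts) = accepts (derivation_of (ts the_arg)).
  rewrite /= inE /is_final /= nth_map_enum value_ground //.
  by rewrite (_ : Ordinal _ = the_arg) //; apply: ord_inj.
split=> [/setP/(_ [tuple])|acc]; first by rewrite inE in_setT E.
by apply/setP => a; rewrite inE in_setT tuple0 E.
Qed.

End Acceptance.

(** * A multi-tape machine as a stack machine, and its realizability instance *)

Section Instance.
Variables (M : machine) (k : nat).
Notation tapesM := 'I_(extra_tapes M).+1.
Notation A := (cell (letter M)).

(* Each tape is split into its scanned cell, kept in the control state, and
   the stacks of the cells before ([false]) and after ([true]) it. The control
   state [None] loads the input. *)
Definition stack_index : finType := (tapesM * bool)%type.
Definition control : finType := option (state M * {ffun tapesM -> A}).

Definition input_stack : stack_index := (ord0, true).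

(** With the scanned cells in the control state, the operation on each stack is determined without
    looking at its top. [End] pops the first input letter, which [control_next] places under the
    head of the first tape. *)
Definition control_op (c : control) (s : signal) (i : stack_index) : stack_op A :=
  match c with
  | None =>
      if i == input_stack then
        match s with Bit b => Push (Some (inl b)) | End => Pop | Run => Keep end
      else Keep
  | Some (q, v) =>
      if halting q then Keep else
      let a := (transition q v).2 i.1 in
      match a.2, i.2 with
      | Left, false | Right, true => Pop
      | Left, true | Right, false => Push a.1
      | Stay, _ => Keep
      end
  end.

Definition control_next (c : control) (s : signal) (h : {ffun stack_index -> A}) :
    control :=
  match c with
  | None =>
      if s is End then
        Some (start M, [ffun i => if i == ord0 then h input_stack else None])
      else None
  | Some (q, v) =>
      if halting q then c else
      let (q', act) := transition q v in
      Some (q', [ffun i => match (act i).2 with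
                 | Left => h (i, false)
                 | Stay => (act i).1
                 | Right => h (i, true)
                 end])
  end.

Definition control_accepts (c : control) : bool :=
  if c is Some (q, _) then halting q && accepting q else false.

Notation factM := (fact stack_index A control).

Definition machine_rule (input : nat -> signal) :
    symbol stack_index -> option factM -> option factM -> option factM :=
  fact_rule None control_op control_next (fun c => c == None) None input.

Definition machine_final (x : factM) : bool :=
  if x is inl (inl (c, _)) then control_accepts c else false.

Section Word.
Variables (w : seq bool) (m : nat).
Let n := size w.

(** The word is pushed last letter first, so that its beginning ends up on top. *)
Definition load_signal (i : nat) : signal :=
  if i < n then Bit (nth false w (n - i.+1)) else End.

Definition control_at (i : nat) : control :=
  if i <= n then None else
  let c := run M w (i - n.+1) in
  Some (current c, [ffun j => scanned (tapes c j)]).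

Definition stack_at (i : nat) (j : stack_index) : seq A :=
  if i <= n then
    if j == input_stack then [seq Some (inl b) | b <- drop (n - i) w] else [::]
  else
    let t := tapes (run M w (i - n.+1)) j.1 in if j.2 then after t else before t.

Lemma sgn_load i : i <= n -> sgn load_signal n i = load_signal i.
Proof. by rewrite /sgn => ->. Qed.

Lemma control_at_load i : i <= n -> control_at i = None.
Proof. by rewrite /control_at => ->. Qed.

Lemma control_at_run u : control_at (n.+1 + u) =
  Some (current (run M w u), [ffun j => scanned (tapes (run M w u) j)]).
Proof. by rewrite /control_at addSn ltnNge leq_addr /= -addSn addKn. Qed.

Lemma stack_at_load i j : i <= n -> stack_at i j =
  if j == input_stack then [seq Some (inl b) | b <- drop (n - i) w] else [::].
Proof. by rewrite /stack_at => ->. Qed.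

Lemma stack_at_run u j : stack_at (n.+1 + u) j =
  if j.2 then after (tapes (run M w u) j.1) else before (tapes (run M w u) j.1).
Proof. by rewrite /stack_at addSn ltnNge leq_addr /= -addSn addKn. Qed.

Lemma time_cases i : [\/ i < n, i = n | exists u, i = n.+1 + u].
Proof.
case: (ltngtP i n) => [lt_in|lt_ni|->]; [exact: Or31| |exact: Or32].
by apply: Or33; exists (i - n.+1); rewrite subnKC.
Qed.

Lemma runS u : run M w u.+1 = step (run M w u).
Proof. by []. Qed.

Lemma control_atS i : control_at i.+1 =
  control_next (control_at i) (sgn load_signal n i)
    [ffun j => head None (stack_at i j)].
Proof.
case: (time_cases i) => [lt_in|->|[u ->]].
- by rewrite !control_at_load ?(ltnW lt_in) // (sgn_load (ltnW lt_in)) /load_signal lt_in.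
- rewrite -[n.+1 in LHS]addn0 control_at_run control_at_load //.
  rewrite (sgn_load (leqnn n)) /load_signal ltnn.
  congr (Some (_, _)); apply/ffunP => j; rewrite !ffunE stack_at_load // eqxx subnn drop0.
  by rewrite /run /init /=; case: (j == ord0).
- rewrite -addnS !control_at_run runS; set c := run M w u.
  rewrite /control_next /step; case: ifP => // _; case: (transition _ _) => q act.
  congr (Some (_, _)); apply/ffunP => j; rewrite !ffunE.
  by rewrite !stack_at_run /=; case: (act j) => a [].
Qed.

Lemma stack_atS i j : stack_at i.+1 j =
  match control_op (control_at i) (sgn load_signal n i) j with
  | Keep => stack_at i j
  | Pop => behead (stack_at i j)
  | Push a => a :: stack_at i j
  end.
Proof.
case: (time_cases i) => [lt_in|->|[u ->]].
- rewrite !stack_at_load ?(ltnW lt_in) // control_at_load ?(ltnW lt_in) //.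
  rewrite (sgn_load (ltnW lt_in)) /load_signal lt_in /control_op.
  case: eqP => // _; rewrite -map_cons; congr map.
  rewrite (drop_nth false); last by rewrite -/n; lia.
  by congr (_ :: drop _ _); lia.
- rewrite -[n.+1 in LHS]addn0 stack_at_run control_at_load // stack_at_load //.
  rewrite (sgn_load (leqnn n)) /load_signal ltnn subnn drop0 /control_op.
  case: j => j b; rewrite /run /init /iter /tapes /input_stack xpair_eqE.
  by case: b; rewrite ?andbF ?andbT //=; case: (j == ord0).
- rewrite -addnS !stack_at_run control_at_run runS; set c := run M w u.
  case: j => j []; rewrite /control_op /step /=; case: ifP => // _;
  by case: (transition _ _) => q act /=; case: (act j) => a [].
Qed.

Lemma control_at_loading i : (control_at i == None) = (i <= n).
Proof. by rewrite /control_at; case: (i <= n). Qed.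

Definition symbols : seq (symbol stack_index) :=
  Init :: [seq Root j | j <- enum stack_index] ++ [:: Join; Link; Self] ++
  [seq Fill l | l <- iota 0 m] ++ [seq Next l | l <- iota 0 m].

Notation tau := (automaton_sig symbols).

Definition example (Y : finType)
    (rule : symbol stack_index -> option Y -> option Y -> option Y) (final : pred Y) :
    {B : structure tau & {set 0.-tuple (dom B)}} :=
  existT _ (automaton rule final symbols) setT.

Definition reduction_instance : instance k :=
  @Instance k tau 0
    (example (machine_rule load_signal) machine_final ::
     [seq example (bit_rule (K := stack_index) j) predT | j <- iota 0 m])
    (ground_grammar k symbols).

Lemma symbol_index (s : symbol stack_index) : s = Init \/ valid_symbol m s ->
  exists2 i, i < size symbols & nth Init symbols i = s.
Proof.
have cat_l s1 s2 : (exists2 i, i < size s1 & nth Init s1 i = s) ->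
    exists2 i, i < size (s1 ++ s2) & nth Init (s1 ++ s2) i = s.
  by case=> i lt_i Ei; exists i; rewrite ?nth_cat ?lt_i // size_cat ltn_addr.
have cat_r s1 s2 : (exists2 i, i < size s2 & nth Init s2 i = s) ->
    exists2 i, i < size (s1 ++ s2) & nth Init (s1 ++ s2) i = s.
  case=> i lt_i Ei; exists (size s1 + i); first by rewrite size_cat ltn_add2l.
  by rewrite nth_cat ltnNge leq_addr /= addKn.
have map_in (T : eqType) (f : T -> symbol stack_index) l x : x \in l -> f x = s ->
    exists2 i, i < size (map f l) & nth Init (map f l) i = s.
  by move=> xl <-; exists (index x l); rewrite ?size_map ?(nth_map x) ?index_mem ?nth_index.
rewrite /symbols -cat1s; case: s cat_l cat_r map_in => [|j||||l|l] cat_l cat_r map_in;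
  case=> // valid_s.
- by exists 0.
- by apply: (cat_r _ _); apply: (cat_l _ _); apply: (map_in _ _ _ j); rewrite ?mem_enum.
- by apply: (cat_r _ _); apply: (cat_r _ _); apply: (cat_l _ _); exists 0.
- by apply: (cat_r _ _); apply: (cat_r _ _); apply: (cat_l _ _); exists 1.
- by apply: (cat_r _ _); apply: (cat_r _ _); apply: (cat_l _ _); exists 2.
- by do 3 apply: (cat_r _ _); apply: (cat_l _ _); apply: (map_in _ _ _ l); rewrite ?mem_iota.
- by do 4 apply: (cat_r _ _); apply: (map_in _ _ _ l); rewrite ?mem_iota.
Qed.

Lemma eval_fact d : eval (machine_rule load_signal) d =
  fact_value None control_op control_next (fun c => c == None) None load_signal d.
Proof. by elim: d => //= s d1 -> d2 ->. Qed.

Lemma eval_bit j d : eval (bit_rule (K := stack_index) j) d = bit_value j d.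
Proof. by elim: d => //= s d1 -> d2 ->. Qed.

Lemma ground_valid (t : term tau k) : ground t -> valid m (derivation_of t).
Proof.
elim: t => // f ts IH gr /=.
have lt_f : f < size symbols by case: f {ts IH gr} => f; rewrite /= size_map.
have /all_nthP/(_ f lt_f) : all (fun s => if s is Init then true else valid_symbol m s) symbols.
  rewrite /symbols -cat1s !all_cat; apply/and5P; split=> //; rewrite all_map;
  by apply/allP => l /=; rewrite ?mem_iota.
move=> /(_ Init) valid_f.
have args i : i < fun_ar f ->
    valid m (nth Leaf [seq derivation_of (ts i) | i <- enum 'I_(fun_ar f)] i).
  by move=> lt_i; rewrite nth_map_enum; apply: IH; apply: gr.
move: (fun_arE f) valid_f; case Es : (nth _ _ _) => //= Ear vs;
  by rewrite ?vs !args ?Ear.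
Qed.

Lemma realizable_derivation : realizable reduction_instance <->
  exists d : derivation stack_index, [/\ valid m d,
    accepts (machine_rule load_signal) machine_final d &
    forall j, j < m -> accepts (bit_rule (K := stack_index) j) predT d].
Proof.
split=> [[phi [/generated_ground[R [ts [-> gr]]] _ ans]]|[d [val acc_fact acc_bit]]].
  have ER := final_symbolE R; subst R.
  exists (derivation_of (ts (the_arg symbols))); split; first exact: ground_valid.
    apply/(answers_atom (machine_rule load_signal) machine_final gr).
    by apply: (ans (example _ _)); left.
  move=> j lt_j; apply/(answers_atom (bit_rule (K := stack_index) j) predT gr).
  apply: (ans (example _ _)); right; apply/In_map.
  by exists j; rewrite ?mem_iota.
have [|t gr_t Ed] := derivation_of_surj k _ (symbol_index (or_introl (erefl Init))) val.
  by move=> s vs; apply: symbol_index; right.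
have gr : forall i : 'I_(rel_ar (final_symbol symbols)), ground ((fun=> t) i) by [].
exists (@Atom tau k (final_symbol symbols) (fun=> t)); split.
- exact: ground_generated.
- have E0 : [set x : 'I_k | x < 0] = set0 by apply/setP => x; rewrite !inE.
  rewrite /free_exactly /= E0 big1 ?cards0 // => i _; exact: ground_fv.
- move=> E [<-|/In_map[j j_m ->]].
    by apply/(answers_atom (machine_rule load_signal) machine_final gr); rewrite Ed.
  apply/(answers_atom (bit_rule (K := stack_index) j) predT gr); rewrite Ed.
  by apply: acc_bit; move: j_m; rewrite mem_iota.
Qed.

Lemma load_signal_not_run i : load_signal i <> Run.
Proof. by rewrite /load_signal; case: ifP. Qed.

Lemma realizable_run : realizable reduction_instance <->
  exists2 i, clock n i < 2 ^ m & control_accepts (control_at i).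
Proof.
have stack0 j : stack_at 0 j = [::].
  by rewrite stack_at_load // subn0 drop_size; case: eqP.
rewrite realizable_derivation.
rewrite -(derivesP m load_signal_not_run (control_at_load (leq0n n)) stack0
  control_atS stack_atS control_at_loading control_accepts).
split=> [[d [val acc_fact acc_bit]]|[d [c [g [t [u [val [fact_d bit_d] acc_c]]]]]]].
  move: acc_fact; rewrite /accepts eval_fact; case E : fact_value => [[[[c g]|]|]|] //= acc_c.
  (* The bits of the two times are read off the final states; acceptance with [predT] says exactly
     that these states are alive. *)
  exists d, c, g, (fun j => (odflt (false, false) (bit_value j d)).1),
    (fun j => (odflt (false, false) (bit_value j d)).2); split=> //; split=> // j /acc_bit.
  by rewrite /accepts eval_bit; case: bit_value => [[]|].
exists d; split=> //; first by rewrite /accepts eval_fact fact_d.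
by move=> j lt_j; rewrite /accepts eval_bit bit_d.
Qed.

End Word.

Lemma run_halted w t u : halted (run M w t) -> t <= u -> run M w u = run M w t.
Proof.
move=> halt /subnKC <-; elim: (u - t) => [|v IH]; first by rewrite addn0.
by rewrite addnS runS IH /step; move: halt; rewrite /halted => ->.
Qed.

(** The halting configuration has stamp 2^(n+1) - 1 + t for n = [size w], which the bound makes
    smaller than 2^m. Conversely, the run is constant once halted, so any halted configuration found
    within the clock range has the same verdict. *)
Lemma realizable_decides w m t : halted (run M w t) ->
  2 ^ (size w).+1 + t <= 2 ^ m ->
  realizable (reduction_instance w m) <-> accepting (current (run M w t)).
Proof.
move=> halt le_m; rewrite realizable_run; split=> [[i _]|acc].
  case: (leqP i (size w)) => [le_i|lt_i]; first by rewrite control_at_load.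
  rewrite -(subnKC lt_i) control_at_run /= => /andP[halt_i].
  case: (leqP t (i - (size w).+1)) => [le_t|/ltnW le_t].
    by rewrite (run_halted halt le_t).
  by rewrite (run_halted halt_i le_t).
exists ((size w).+1 + t); last by rewrite control_at_run /= acc andbT.
have := expn_gt0 2 (size w).+1; rewrite /clock.
case: (leqP _ (size w).+1) => [le_t|_ ?]; last by lia.
have -> : t = 0 by lia.
by rewrite addn0; lia.
Qed.

End Instance.

(** * The encoding of the reduction *)

(** Plain lists instead of tuples, so that tables of symbols with merely provably equal arities have
    comparable types. *)
Fixpoint lex_seqs (T : Type) (s : seq T) (a : nat) : seq (seq T) :=
  if a is a'.+1 then [seq x :: t | x <- s, t <- lex_seqs s a'] else [:: [::]].

Lemma lex_seqsE (T : Type) (s : seq T) a :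
  [seq tval t | t <- lex_tuples s a] = lex_seqs s a.
Proof.
elim: a => //= a <-; elim: s {1 3}s => //= x s IH s'.
by rewrite map_cat IH -!map_comp.
Qed.

Lemma flatten_map_iota (T : Type) (x0 : T) (U : Type) (f : T -> seq U) (s : seq T) :
  flatten [seq f x | x <- s] = flatten [seq f (nth x0 s i) | i <- iota 0 (size s)].
Proof. by rewrite -{1}[s](mkseq_nth x0) /mkseq -map_comp. Qed.

Lemma flatten_map_enum (U : Type) (f : nat -> seq U) N :
  flatten [seq f (nat_of_ord i) | i <- enum 'I_N] = flatten [seq f i | i <- iota 0 N].
Proof. by rewrite -val_enum_ord -map_comp. Qed.

Section Tables.
Variables (K Y : finType).

Definition table (rule : symbol K -> option Y -> option Y -> option Y) (s : symbol K) :
    seq nat :=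
  [seq nat_of_ord (apply_rule rule s t) | t <- lex_seqs (enum 'I_#|Y|.+1) (arity s)].

Lemma eq_table rule rule' s s' : arity s = arity s' ->
  (forall x y, rule s x y = rule' s' x y) -> table rule s = table rule' s'.
Proof.
move=> Ear Er; rewrite /table Ear; apply: eq_map => t.
by rewrite /apply_rule Er.
Qed.

Definition final_table (final : pred Y) : seq nat :=
  [seq nat_of_bool (is_final final t) | t <- lex_seqs (enum 'I_#|Y|.+1) 1].

Definition automaton_head (final : pred Y) : seq nat := #|Y|.+1 :: final_table final.

Lemma enc_automaton rule final (syms : seq (symbol K)) :
  enc_structure (automaton rule final syms) =
  automaton_head final ++ flatten [seq table rule s | s <- syms].
Proof.
rewrite /enc_structure /= /automaton_head; congr (_ :: _ ++ _).
  rewrite enum_ordSl /= enum_ord0 /= cats0 /enc_set /final_table -lex_seqsE -map_comp.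
  by apply: eq_map => t /=; rewrite inE.
rewrite (flatten_map_iota Init) -[size syms](size_map (@arity K)) -flatten_map_enum.
congr flatten; apply: eq_map => f.
rewrite /enc_fun /table -fun_arE -lex_seqsE -map_comp; apply: eq_map => t /=.
by rewrite ffunE.
Qed.

End Tables.

Lemma enc_set_unit B : enc_set ([set: 0.-tuple 'I_B]) = [:: 1].
Proof. by rewrite /enc_set /= in_setT. Qed.

Section Grammar.
Variables (K : finType) (k : nat) (syms : seq (symbol K)).

Lemma enc_symbol_tree (s : fo_symbol (automaton_sig syms) k) :
  enc_tree (@enc_symbol (automaton_sig syms) k 2) (symbol_tree s) =
  enc_symbol (inl s : _ + 'I_2) ++ flatten (nseq (fo_rank s) [:: 9; 1]).
Proof.
have const (l : seq 'I_(fo_rank s)) : [seq [:: 9; 1] | i <- l] = nseq (size l) [:: 9; 1].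
  by elim: l => //= i l ->.
have leafE : enc_tree (@enc_symbol (automaton_sig syms) k 2) (leaf (@fo_rank _ k) n_term) = [:: 9; 1].
  by rewrite /= enum_ord0.
rewrite [LHS]/=; congr (_ ++ flatten _).
rewrite -[n in nseq n](size_enum_ord) -const; apply: eq_map => i; exact: leafE.
Qed.

(** [[:: 9; 1]] is the leaf [n_term]. The prefix contains the first rule, [0; 0; 0; 9; 1]: left-hand
    side [n_formula], relation symbol 0, its argument. *)
Lemma enc_ground_grammar : enc_grammar (ground_grammar k syms) =
  [:: 2; 0; (size syms).+1; 0; 0; 0; 9; 1] ++
  flatten [seq [:: 1; 1; i] ++ flatten (nseq (arity (nth Init syms i)) [:: 9; 1])
          | i <- iota 0 (size syms)].
Proof.
have Esz : size (rules (ground_grammar k syms)) = (size syms).+1.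
  by rewrite /= size_map size_enum_ord size_map.
pose code (p : 'I_2 * tree (@ext_rank _ (@fo_rank (automaton_sig syms) k) 2)) := nat_of_ord p.1 :: enc_tree (@enc_symbol (automaton_sig syms) k 2) p.2.
transitivity ([:: 2; 0; (size syms).+1] ++ code (n_formula, symbol_tree (SRel (final_symbol syms))) ++
  flatten [seq code p | p <- [seq (n_term, symbol_tree (SFun f)) | f <- enum (fun_symbol (automaton_sig syms))]]).
  by rewrite /enc_grammar Esz.
rewrite {1}/code enc_symbol_tree; congr ([:: 2; 0; _; 0; 0; 0; 9; 1] ++ _).
rewrite -map_comp -[in RHS](size_map (@arity K)) -flatten_map_enum.
congr flatten; apply: eq_map => f.
by rewrite /= -fun_arE; apply: (congr1 (cons 1) (enc_symbol_tree (SFun f))).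
Qed.

End Grammar.

Lemma map_const_in (T : eqType) (U : Type) (f : T -> U) (c : U) (s : seq T) :
  (forall x, x \in s -> f x = c) -> [seq f x | x <- s] = nseq (size s) c.
Proof.
elim: s => //= x s IH fc; rewrite fc ?mem_head // IH // => y ys.
by rewrite fc // inE ys orbT.
Qed.

Section Encoding.
Variable M : machine.
Notation K := (stack_index M).

Definition base_symbols : seq (symbol K) :=
  Init :: [seq Root j | j <- enum K] ++ [:: Join; Link; Self].

(** The rule of [Fill l] depends on [l] only through the signal at [l], so index 0 under a constant
    input stands for all of them. *)
Definition load_table (s : signal) : seq nat :=
  table (machine_rule (M := M) (fun=> s)) (Fill 0).
Definition next_table : seq nat := table (machine_rule (M := M) (fun=> End)) (Next 0).
Definition control_base : seq nat :=
  automaton_head (@machine_final M) ++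
  flatten [seq table (machine_rule (M := M) (fun=> End)) s | s <- base_symbols].

Definition bit_table (s : symbol K) (j : nat) : seq nat := table (bit_rule (K := K) j) s.
Definition bit_base : seq nat :=
  automaton_head (@predT (bool * bool)) ++ flatten [seq bit_table s 0 | s <- base_symbols].

Lemma symbolsE m : symbols M m =
  base_symbols ++ [seq Fill l | l <- iota 0 m] ++ [seq Next l | l <- iota 0 m].
Proof. by rewrite /symbols /base_symbols /= -catA. Qed.

Lemma in_base_symbols (T : Type) (f g : symbol K -> T) :
  (forall s, match s with Fill _ | Next _ => True | _ => f s = g s end) ->
  [seq f s | s <- base_symbols] = [seq g s | s <- base_symbols].
Proof.
move=> fg; rewrite /base_symbols /= (fg Init) !map_cat -!map_comp /=.
rewrite (fg Join) (fg Link) (fg Self); congr (_ :: _ ++ _).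
by apply: eq_map => j; apply: (fg (Root j)).
Qed.

Definition control_code (w : seq bool) (m : nat) : seq nat :=
  control_base ++
  flatten [seq load_table (Bit (nth false w (size w - i.+1))) | i <- iota 0 (size w)] ++
  flatten (nseq (m - size w) (load_table End)) ++ flatten (nseq m next_table) ++ [:: 1].

Lemma enc_exampleE m (Y : finType) (rule : symbol K -> option Y -> option Y -> option Y) final :
  enc_example (example m rule final) =
  automaton_head final ++ flatten [seq table rule s | s <- base_symbols] ++
  flatten [seq table rule (Fill l) | l <- iota 0 m] ++
  flatten [seq table rule (Next l) | l <- iota 0 m] ++ [:: 1].
Proof.
rewrite -(enc_set_unit #|Y|.+1).
transitivity (enc_structure (automaton rule final (symbols M m)) ++ enc_set ([set: 0.-tuple 'I_#|Y|.+1])).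
  by [].
rewrite enc_automaton symbolsE; move: base_symbols => base.
by rewrite !map_cat !flatten_cat -!map_comp -!catA.
Qed.

Lemma enc_control w m : size w <= m ->
  enc_example (example m (machine_rule (M := M) (load_signal w)) (@machine_final M)) =
  control_code w m.
Proof.
move=> le_nm; rewrite enc_exampleE.
rewrite /control_code /control_base -catA.
congr (_ ++ _); rewrite (@in_base_symbols _ _ (table (machine_rule (M := M) (fun=> End)))).
  congr (_ ++ _); rewrite -{1}(subnKC le_nm) iotaD map_cat flatten_cat -catA add0n.
  congr (_ ++ _); last congr (_ ++ _).
  - congr flatten; apply/eq_in_map => i; rewrite mem_iota => lt_i.
    by apply: eq_table => // x y; rewrite /machine_rule /fact_rule /load_signal (lt_i : i < _).
  - rewrite (@map_const_in _ _ _ (load_table End)) ?size_iota // => i.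
    rewrite mem_iota => /andP[le_i _]; apply: eq_table => // x y.
    by rewrite /machine_rule /fact_rule /load_signal ltnNge le_i.
  - rewrite (@map_const_in _ _ _ next_table); last by move=> i _; apply: eq_table.
    by rewrite size_iota.
by case=> // *; apply: eq_table.
Qed.

(** The pairs (0, 1), (0, 0) and (1, 0) represent the three outcomes of [bit_order]; they occur for
    [j], one and [r] values of [l] respectively. *)
Definition tick_code (j r : nat) (s : nat -> symbol K) : seq nat :=
  flatten (nseq j (bit_table (s 0) 1)) ++ bit_table (s 0) 0 ++
  flatten (nseq r (bit_table (s 1) 0)).

Definition bit_code (j r : nat) : seq nat :=
  bit_base ++ tick_code j r Fill ++ tick_code j r Next ++ [:: 1].

Lemma tick_codeE (s : nat -> symbol K) j m : j < m ->
  (forall l j l' j', bit_order l j = bit_order l' j' -> bit_table (s l) j = bit_table (s l') j') ->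
  flatten [seq bit_table (s l) j | l <- iota 0 m] = tick_code j (m - j.+1) s.
Proof.
move=> lt_jm eq_s; rewrite -{1}(subnKC (ltnW lt_jm)) -subnSK // iotaD add0n /=.
rewrite map_cat flatten_cat /=; congr (flatten _ ++ _ ++ flatten _).
- rewrite (@map_const_in _ _ _ (bit_table (s 0) 1)) ?size_iota // => l.
  by rewrite mem_iota => /= lt_l; apply: eq_s; rewrite /bit_order lt_l.
- by apply: eq_s; rewrite /bit_order ltnn eqxx.
- rewrite (@map_const_in _ _ _ (bit_table (s 1) 0)) ?size_iota // => l.
  rewrite mem_iota => /andP[lt_l _]; apply: eq_s.
  by rewrite /bit_order ltnNge (ltnW lt_l) /= gtn_eqF.
Qed.

Lemma enc_bit m j : j < m ->
  enc_example (example m (bit_rule (K := K) j) predT) = bit_code j (m - j.+1).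
Proof.
move=> lt_jm; rewrite enc_exampleE.
rewrite /bit_code /bit_base -catA.
congr (_ ++ _); rewrite (@in_base_symbols _ _ (bit_table^~ 0)); last first.
  by case=> // *; apply: eq_table.
congr (_ ++ _); rewrite (tick_codeE (s := Fill)) ?(tick_codeE (s := Next)) //.
- by move=> l1 j1 l2 j2 E; apply: eq_table => // x y; rewrite /bit_rule E.
- by move=> l1 j1 l2 j2 E; apply: eq_table => // x y; rewrite /bit_rule E.
Qed.

End Encoding.

Section Whole.
Variables (M : machine) (k : nat).
Notation K := (stack_index M).

Definition num_base : nat := (size (base_symbols M)).-1.

(** Left-hand side [n_term], then a function symbol with two [n_term] leaves. The index is shifted
    because symbol 0 is [Init]. *)
Definition rule_code (i : nat) : seq nat := [:: 1; 1; i.+1; 9; 1; 9; 1].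

(** [N] counts the binary symbols. There are [N.+1] function symbols with [Init], and [N.+2] rules
    with the one for the atom; the trailing [1; 1; 0] of the grammar prefix is the rule for
    [Init]. *)
Definition instance_code (w : seq bool) (m : nat) : seq nat :=
  let N := num_base + (m + m) in
  [:: 1; 1; N.+1; 0] ++ flatten (nseq N [:: 2]) ++ [:: 0; m.+1] ++
  control_code M w m ++
  flatten [seq bit_code M j (m - j.+1) | j <- iota 0 m] ++
  [:: 2; 0; N.+2; 0; 0; 0; 9; 1; 1; 1; 0] ++
  flatten [seq rule_code i | i <- iota 0 N].

Lemma size_symbols m : size (symbols M m) = (num_base + (m + m)).+1.
Proof. by rewrite symbolsE !size_cat !size_map !size_iota. Qed.

Lemma all_arity_symbols m : all (fun s => arity s == 2) (behead (symbols M m)).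
Proof.
rewrite -[behead _]/([seq Root j | j <- enum K] ++ [:: Join; Link; Self] ++
  [seq Fill l | l <- iota 0 m] ++ [seq Next l | l <- iota 0 m]) !all_cat.
apply/and4P; split=> //; rewrite all_map;
  by apply/allP.
Qed.

Lemma arity_symbols m i : i < num_base + (m + m) -> arity (nth Init (symbols M m) i.+1) = 2.
Proof.
move=> lt_i; have lt_i' : i < size (behead (symbols M m)) by rewrite size_behead size_symbols.
by have /(all_nthP Init)/(_ i lt_i')/eqP := all_arity_symbols m; rewrite nth_behead.
Qed.

Lemma map_arity_symbols m :
  map (@arity K) (symbols M m) = 0 :: nseq (num_base + (m + m)) 2.
Proof.
apply: (@eq_from_nth _ 0); first by rewrite /= size_map size_nseq -size_symbols.
move=> i; rewrite size_map => lt_i; rewrite (nth_map Init) //; case: i lt_i => // i.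
rewrite size_symbols ltnS => lt_i; rewrite arity_symbols //=.
by rewrite nth_nseq lt_i.
Qed.

Lemma enc_reduction w m : size w <= m ->
  enc_instance (reduction_instance M k w m) = instance_code w m.
Proof.
move=> le_nm; set N := num_base + (m + m).
have Esig : enc_signature (automaton_sig (symbols M m)) = [:: 1; 1; N.+1; 0] ++ nseq N 2.
  transitivity ([:: 1; 1; size (map (@arity K) (symbols M m))] ++ map (@arity K) (symbols M m)).
    by [].
  by rewrite size_map size_symbols map_arity_symbols.
have Eex : flatten [seq enc_example E | E <- examples (reduction_instance M k w m)] =
    control_code M w m ++ flatten [seq bit_code M j (m - j.+1) | j <- iota 0 m].
  pose bits := [seq example m (bit_rule (K := K) j) predT | j <- iota 0 m].
  have -> : examples (reduction_instance M k w m) =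
    example m (machine_rule (M := M) (load_signal w)) (@machine_final M) :: bits by [].
  rewrite -[LHS]/(enc_example _ ++ flatten (map _ bits)) enc_control //; congr (_ ++ flatten _).
  by rewrite -map_comp; apply/eq_in_map => j; rewrite mem_iota => lt_j; apply: enc_bit.
have Egram : enc_grammar (ground_grammar k (symbols M m)) =
    [:: 2; 0; N.+2; 0; 0; 0; 9; 1; 1; 1; 0] ++ flatten [seq rule_code i | i <- iota 0 N].
  rewrite enc_ground_grammar size_symbols -/N /= (iotaDl 1 0 N) -map_comp.
  congr [:: _, _, _, _, _, _, _, _, _, _, _ & flatten _].
  apply/eq_in_map => i; rewrite mem_iota => lt_i /=.
  by rewrite arity_symbols.
transitivity (enc_signature (automaton_sig (symbols M m)) ++
  [:: 0, m.+1 & flatten [seq enc_example E | E <- examples (reduction_instance M k w m)]] ++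
  enc_grammar (ground_grammar k (symbols M m))).
  have {1}<- : size (examples (reduction_instance M k w m)) = m.+1.
    by rewrite /= size_map size_iota.
  by [].
rewrite Esig Eex Egram /instance_code -/N.
have -> : flatten (nseq N [:: 2]) = nseq N 2 by elim: (N) => //= ? ->.
move: (control_code M w m) (flatten [seq bit_code M j _ | j <- _]) => c b.
by rewrite /= -!catA.
Qed.

End Whole.

(** * Composable pieces of Turing machines with time bounds *)

Section Fragments.
Variables (n : nat) (A : finType).
Notation cellA := (cell A).
Notation tapesA := ('I_n -> tape A).

Record fragment := Fragment {
  fstate : finType;
  fstart : fstate;
  fhalt : pred fstate;
  ftrans : fstate -> {ffun 'I_n -> cellA} ->
    fstate * ('I_n -> cellA * direction)
}.

Definition act_on (a : 'I_n -> cellA * direction) (c : tapesA) : tapesA :=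
  fun i => shift (a i).2 (write (a i).1 (c i)).

Definition heads (c : tapesA) : {ffun 'I_n -> cellA} :=
  [ffun i => scanned (c i)].

Inductive frun (F : fragment) (q : fstate F) (c : tapesA) :
    nat -> fstate F -> tapesA -> Prop :=
  | frun0 : frun q c 0 q c
  | frunS m q' c' : ~~ fhalt q ->
      frun (ftrans q (heads c)).1 (act_on (ftrans q (heads c)).2 c) m q' c' ->
      frun q c m.+1 q' c'.

Lemma frun_trans (F : fragment) (q q' q'' : fstate F) c c' c'' m m' :
  frun q c m q' c' -> frun q' c' m' q'' c'' -> frun q c (m + m') q'' c''.
Proof.
by elim=> {q c m q' c'} // q c m q' c' nh _ IH /IH; apply: frunS.
Qed.

(** Control passes between components in a step that writes back the scanned cells; this accounts
    for the extra units in the time bounds. *)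
Definition idle (v : {ffun 'I_n -> cellA}) : 'I_n -> cellA * direction :=
  fun i => (v i, Stay).

Lemma act_on_idle c : act_on (idle (heads c)) c = c.
Proof.
by apply: functional_extensionality => i; rewrite /act_on /= ffunE; case: (c i).
Qed.

Definition prim (i : 'I_n) (f : cellA -> cellA * direction) : fragment :=
  @Fragment bool false id (fun _ v =>
    (true, fun j => if j == i then f (v j) else (v j, Stay))).

Definition seqF (F G : fragment) : fragment :=
  @Fragment (fstate F + fstate G)%type (inl (fstart F))
    (fun s => if s is inr q then fhalt q else false)
    (fun s v => match s with
      | inl q => if fhalt q then (inr (fstart G), idle v)
                 else (inl (ftrans q v).1, (ftrans q v).2)
      | inr q => (inr (ftrans q v).1, (ftrans q v).2)
      end).

Definition ifF (i : 'I_n) (P : pred cellA) (F G : fragment) : fragment :=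
  @Fragment (option (fstate F + fstate G)) None
    (fun s => match s with
       | Some (inl q) => fhalt q | Some (inr q) => fhalt q | None => false end)
    (fun s v => match s with
      | None => (Some (if P (v i) then inl (fstart F) else inr (fstart G)), idle v)
      | Some (inl q) => (Some (inl (ftrans q v).1), (ftrans q v).2)
      | Some (inr q) => (Some (inr (ftrans q v).1), (ftrans q v).2)
      end).

(* [None] tests the loop condition and [Some None] is the final state. *)
Definition whileF (i : 'I_n) (P : pred cellA) (F : fragment) : fragment :=
  @Fragment (option (option (fstate F))) None
    (fun s => if s is Some None then true else false)
    (fun s v => match s with
      | None => (Some (if P (v i) then Some (fstart F) else None), idle v)
      | Some (Some q) => if fhalt q then (None, idle v)
                         else (Some (Some (ftrans q v).1), (ftrans q v).2)
      | Some None => (Some None, idle v)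
      end).

Definition fexec (F : fragment) (c : tapesA) (m : nat) (c' : tapesA) : Prop :=
  exists m' q, [/\ m' <= m, frun (fstart F) c m' q c' & fhalt q].

Lemma fexec_prim i f c :
  fexec (prim i f) c 1
    (fun j => if j == i then shift (f (scanned (c j))).2
                              (write (f (scanned (c j))).1 (c j)) else c j).
Proof.
exists 1, true; split=> //; apply: frunS => //=.
set c' := (c' in frun _ _ _ _ c').
suff -> : act_on (fun j => if j == i then f (heads c j) else (heads c j, Stay)) c = c'.
  exact: frun0.
apply: functional_extensionality => j; rewrite /act_on /c' !ffunE.
by case: (j == i) => //=; case: (c j).
Qed.

Lemma frun_seql F G (q q' : fstate F) c c' m :
  frun q c m q' c' -> @frun (seqF F G) (inl q) c m (inl q') c'.
Proof.
elim=> [q0 c0|q0 c0 m0 q1 c1 nh _ IH]; first exact: frun0.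
by apply: frunS => //=; rewrite (negPf nh).
Qed.

Lemma frun_seqr F G (q q' : fstate G) c c' m :
  frun q c m q' c' -> @frun (seqF F G) (inr q) c m (inr q') c'.
Proof.
elim=> [q0 c0|q0 c0 m0 q1 c1 nh _ IH]; first exact: frun0.
by apply: frunS.
Qed.

Lemma fexec_seq F G c c' c'' m m' :
  fexec F c m c' -> fexec G c' m' c'' -> fexec (seqF F G) c (m + m').+1 c''.
Proof.
case=> k [q [le_k run_q halt_q]] [k' [q' [le_k' run_q' halt_q']]].
exists (k + k'.+1), (inr q'); split=> //; first by lia.
apply: frun_trans (frun_seql _ run_q) _.
apply: frunS => //=; rewrite halt_q /= act_on_idle; exact: frun_seqr.
Qed.

Lemma fexec_if i (P : pred cellA) F G c c' m :
  fexec (if P (scanned (c i)) then F else G) c m c' -> fexec (ifF i P F G) c m.+1 c'.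
Proof.
move=> H.
have frunl (q q' : fstate F) d d' k : frun q d k q' d' ->
    @frun (ifF i P F G) (Some (inl q)) d k (Some (inl q')) d'.
  by elim=> [q0 c0|q0 c0 m0 q1 c1 nh _ IH]; [exact: frun0 | exact: frunS].
have frunr (q q' : fstate G) d d' k : frun q d k q' d' ->
    @frun (ifF i P F G) (Some (inr q)) d k (Some (inr q')) d'.
  by elim=> [q0 c0|q0 c0 m0 q1 c1 nh _ IH]; [exact: frun0 | exact: frunS].
case Pc: (P _) H => -[k [q [le_k run_q halt_q]]].
  exists k.+1, (Some (inl q)); split=> //.
  by apply: frunS => //=; rewrite act_on_idle ffunE Pc; apply: frunl.
exists k.+1, (Some (inr q)); split=> //.
by apply: frunS => //=; rewrite act_on_idle ffunE Pc; apply: frunr.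
Qed.

(** [S j] is the tape contents before round [j]. Each round spends two steps outside the body, on
    the test and on the return to it; the failing test costs one more. *)
Lemma fexec_while i (P : pred cellA) F (S : nat -> tapesA) (t : nat -> nat) e :
  (forall j, j < e -> P (scanned (S j i)) /\ fexec F (S j) (t j) (S j.+1)) ->
  ~~ P (scanned (S e i)) ->
  fexec (whileF i P F) (S 0) (\sum_(j < e) (t j).+2).+1 (S e).
Proof.
have frunl (q q' : fstate F) d d' k : frun q d k q' d' ->
    @frun (whileF i P F) (Some (Some q)) d k (Some (Some q')) d'.
  elim=> [q0 c0|q0 c0 m0 q1 c1 nh _ IH]; first exact: frun0.
  by apply: frunS => //=; rewrite (negPf nh).
elim: e S t => [|e IH] S t loop stop.
  exists 1, (Some None); split=> //.
  by apply: frunS => //=; rewrite act_on_idle ffunE (negPf stop); apply: frun0.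
have [] := IH (fun j => S j.+1) (fun j => t j.+1) => // [j lt_je|k [q [le_k run_q halt_q]]].
  exact: loop.
have [P0 [k0 [q0 [le_k0 run0 halt0]]]] := loop 0 isT.
exists (k0 + k.+1).+1, q; split=> //.
  rewrite big_ord_recl (eq_bigr (fun j : 'I_e => (t j.+1).+2)) //=.
  move: le_k le_k0; set sum := \sum_(_ < _) _; lia.
apply: frunS => //=; rewrite act_on_idle ffunE P0.
apply: frun_trans (frunl _ _ _ _ _ run0) _.
by apply: frunS => //=; rewrite halt0 act_on_idle.
Qed.

End Fragments.

Section FragmentMachine.
Variables (e : nat) (A : finType).

Definition machine_of (F : fragment e.+1 A) : machine :=
  @Machine e (fstate F) A (fstart F) (@fhalt _ _ F) pred0 (@ftrans _ _ F).

Lemma frun_machine (F : fragment e.+1 A) (q q' : fstate F) c c' m :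
  frun q c m q' c' ->
  iter m (@step (machine_of F)) (@Config (machine_of F) q c) =
  @Config (machine_of F) q' c'.
Proof.
elim=> // {q c m q' c'} q c m q' c' nh _ IH.
rewrite iterSr /step /halted /= (negPf nh) -IH.
by rewrite /heads /act_on; case: (ftrans _ _).
Qed.

End FragmentMachine.

(** * Tapes as functions on positions *)

Section Tapes.
Variable A : finType.

(* The head is on cell [p], the cells [i >= 0] hold [f i] and the cells to the
   left of cell [0] are blank. *)
Definition tape_at (f : nat -> cell A) (p : nat) (t : tape A) : Prop :=
  (forall j, nth None (before t) j = if j < p then f (p - j.+1) else None) /\
  (forall j, nth None (scanned t :: after t) j = f (p + j)).

Lemma tape_at_scanned f p t : tape_at f p t -> scanned t = f p.
Proof. by case=> _ /(_ 0); rewrite addn0. Qed.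

Lemma tape_at_right f p t : tape_at f p t -> tape_at f p.+1 (shift Right t).
Proof.
case: t => b s a [/= Hb Ha]; split=> -[|j] /=.
- by move: (Ha 0); rewrite subn1 addn0.
- by rewrite Hb ltnS subSS.
- by move: (Ha 1); rewrite /= nth0 addn0 addn1.
- by move: (Ha j.+2); rewrite /= nth_behead addSnnS.
Qed.

Lemma tape_at_left f p t : tape_at f p.+1 t -> tape_at f p (shift Left t).
Proof.
case: t => b s a [/= Hb Ha]; split=> j /=.
- by rewrite nth_behead Hb ltnS subSS.
- case: j => [|j] /=; first by rewrite -nth0 Hb /= subn1 addn0.
  by rewrite Ha addSnnS.
Qed.

Lemma tape_at_write f p t a : tape_at f p t ->
  tape_at (fun i => if i == p then a else f i) p (write a t).
Proof.
case: t => b s a' [/= Hb Ha]; split=> j /=.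
- by rewrite Hb; case: ltnP => // lt_jp; case: eqP => //; lia.
- case: j => [|j] /=; first by rewrite addn0 eqxx.
  rewrite (_ : (_ == p) = false); last by apply/eqP; lia.
  exact: (Ha j.+1).
Qed.

Lemma tape_at_init w : tape_at (nth None [seq Some (inl b) | b <- w]) 0
  (tape_of_word A w).
Proof. by case: w => [|b w]; split=> -[|j] //=; rewrite ?nth_nil. Qed.

Lemma leading_bits_nth (s s' : seq (cell A)) :
  nth None s =1 nth None s' -> leading_bits s = leading_bits s'.
Proof.
elim: s s' => [|x s IH] [|x' s'] // eq_s.
- by move: (eq_s 0) => /= <-.
- by move: (eq_s 0) => /= ->.
- move: (eq_s 0) => /= ->; case: x' eq_s => [[b|]|] // eq_s.
  by congr cons; apply: IH => j; apply: (eq_s j.+1).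
Qed.

Lemma leading_bits_word w : leading_bits [seq Some (inl b) : cell A | b <- w] = w.
Proof. by elim: w => //= b w ->. Qed.

End Tapes.

(** * Programs over bounded counters *)

Inductive program :=
  | Skip
  | Emit of bool
  | Seq of program & program
  | For of nat & program
  | IfBit of nat & program & program
  | LetC of nat & program
  | LetAdd of nat & nat & program
  | LetMul of nat & nat & program.

(* Variables are de Bruijn levels. [For v g] runs [g] with two new variables,
   the number of iterations done and the number of those left. *)
Fixpoint exec (w : seq bool) (env : seq nat) (g : program) : seq bool :=
  let val v := nth 0 env v in
  match g with
  | Skip => [::]
  | Emit b => [:: b]
  | Seq g1 g2 => exec w env g1 ++ exec w env g2
  | For v g1 =>
      flatten [seq exec w (env ++ [:: i; val v - i.+1]) g1 | i <- iota 0 (val v)]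
  | IfBit v g1 g2 => if nth false w (val v) then exec w env g1 else exec w env g2
  | LetC e g1 => exec w (rcons env e) g1
  | LetAdd a b g1 => exec w (rcons env (val a + val b)) g1
  | LetMul a b g1 => exec w (rcons env (val a * val b)) g1
  end.

Fixpoint scoped (d : nat) (g : program) : bool :=
  match g with
  | Skip | Emit _ => true
  | Seq g1 g2 => scoped d g1 && scoped d g2
  | For v g1 => (v < d) && scoped d.+2 g1
  | IfBit v g1 g2 => [&& v < d, scoped d g1 & scoped d g2]
  | LetC e g1 => scoped d.+1 g1
  | LetAdd a b g1 => [&& a < d, b < d & scoped d.+1 g1]
  | LetMul a b g1 => [&& a < d, b < d & scoped d.+1 g1]
  end.

(* Number of counters used, scratch counters included. *)
Fixpoint width (d : nat) (g : program) : nat :=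
  match g with
  | Skip | Emit _ => d
  | Seq g1 g2 => maxn (width d g1) (width d g2)
  | For v g1 => maxn d.+2 (width d.+2 g1)
  | IfBit v g1 g2 => maxn d.+1 (maxn (width d g1) (width d g2))
  | LetC e g1 => maxn d.+1 (width d.+1 g1)
  | LetAdd a b g1 => maxn d.+2 (width d.+1 g1)
  | LetMul a b g1 => maxn d.+3 (width d.+1 g1)
  end.

Record memory := Memory {
  inpos : nat;
  count : nat -> nat;
  written : seq bool
}.

Definition upd (f : nat -> nat) (v x : nat) : nat -> nat :=
  fun i => if i == v then x else f i.

Definition setc (m : memory) (v x : nat) : memory :=
  Memory (inpos m) (upd (count m) v x) (written m).

Ltac mem_eq := rewrite /setc /=; congr Memory;
  apply: functional_extensionality => ?; rewrite /upd;
  repeat (case: eqP => ?; try subst); try done; try lia.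

(** * Compiling counter programs to machine fragments *)

Section Compile.
Variable s : nat.
Variable w : seq bool.
Notation bitcell b := (Some (inl b) : cell unit).
Notation mark := (Some (inr tt) : cell unit).
Notation frag := (fragment s.+2 unit).

Definition ctape (v : nat) : 'I_s.+2 := inord v.+1.
Definition otape : 'I_s.+2 := ord_max.

(** A counter tape carries only a mark in cell 0, so testing for zero is reading the mark. The mark
    on the output tape is where [rewind] stops. *)
Definition contents (m : memory) (i : nat) : nat -> cell unit :=
  if i == 0 then nth None [seq bitcell b | b <- w]
  else nth None (mark :: if i == s.+1 then [seq bitcell b | b <- written m]
                         else [::]).
Definition position (m : memory) (i : nat) : nat :=
  if i == 0 then inpos m else if i == s.+1 then (size (written m)).+1
  else count m i.-1.

Definition represents (m : memory) (c : 'I_s.+2 -> tape unit) : Prop :=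
  forall i : 'I_s.+2, tape_at (contents m i) (position m i) (c i).

Definition does (F : frag) (m : memory) (t : nat) (m' : memory) : Prop :=
  forall c, represents m c -> exists2 c', fexec F c t c' & represents m' c'.

Definition move (i : 'I_s.+2) (d : direction) : frag := prim i (fun a => (a, d)).
Definition inc (v : nat) : frag := move (ctape v) Right.
Definition dec (v : nat) : frag := move (ctape v) Left.
Definition emit (b : bool) : frag := prim otape (fun=> (bitcell b, Right)).
Definition loop (v : nat) (F : frag) : frag :=
  whileF (ctape v) (fun a => a != mark) (seqF (dec v) F).

Lemma does_le F m t t' m' : t <= t' -> does F m t m' -> does F m t' m'.
Proof.
move=> le_t H c /H [c' [k [q [le_k run halt]]] rep].
exists c' => //; exists k, q; split=> //; exact: leq_trans le_t.
Qed.

Lemma does_seq F G m m' m'' t t' :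
  does F m t m' -> does G m' t' m'' -> does (seqF F G) m (t + t').+1 m''.
Proof.
move=> HF HG c /HF [c' run /HG [c'' run' rep]].
by exists c'' => //; apply: fexec_seq run run'.
Qed.

Lemma ctapeE v : v < s -> ctape v = v.+1 :> nat.
Proof. by move=> lt_vs; rewrite inordK //; lia. Qed.

Lemma write_scanned (A : finType) (t : tape A) : write (scanned t) t = t.
Proof. by case: t. Qed.

Lemma does_move i d m m' :
  (forall j : 'I_s.+2, j != i -> contents m' j = contents m j /\ position m' j = position m j) ->
  contents m' i = contents m i ->
  match d with
  | Left => position m i = (position m' i).+1
  | Stay => position m' i = position m i
  | Right => position m' i = (position m i).+1
  end ->
  does (move i d) m 1 m'.
Proof.
move=> Hj Hc Hp c rep; eexists; first exact: fexec_prim.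
move=> j; case: eqP => [->|/eqP/Hj [-> ->] //] /=.
rewrite write_scanned Hc; have := rep i; case: d Hp => Hp.
- by rewrite Hp; apply: tape_at_left.
- by rewrite Hp.
- by rewrite Hp; apply: tape_at_right.
Qed.

Lemma ord_neq (i j : 'I_s.+2) : (i != j) = (i != j :> nat).
Proof. by []. Qed.

Lemma does_inc v m : v < s -> does (inc v) m 1 (setc m v (count m v).+1).
Proof.
move=> lt_vs; apply: does_move => //.
- move=> j; rewrite ord_neq ctapeE // => ne_j; split=> //.
  by rewrite /position /= /upd; case: (j : nat) ne_j => //= i; rewrite eqSS => /negPf ->.
- by rewrite /position ctapeE //= /upd eqxx eqSS ltn_eqF.
Qed.

Lemma does_dec v m : v < s -> 0 < count m v ->
  does (dec v) m 1 (setc m v (count m v).-1).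
Proof.
move=> lt_vs pos; apply: does_move => //.
- move=> j; rewrite ord_neq ctapeE // => ne_j; split=> //.
  by rewrite /position /= /upd; case: (j : nat) ne_j => //= i; rewrite eqSS => /negPf ->.
- by rewrite /position ctapeE //= /upd eqxx eqSS ltn_eqF // prednK.
Qed.

Lemma does_input_right m :
  does (move ord0 Right) m 1 (Memory (inpos m).+1 (count m) (written m)).
Proof. by apply: does_move => // -[[]]. Qed.

Lemma does_input_left p f o :
  does (move ord0 Left) (Memory p.+1 f o) 1 (Memory p f o).
Proof. by apply: does_move => // -[[]]. Qed.

Lemma does_emit b m :
  does (emit b) m 1 (Memory (inpos m) (count m) (rcons (written m) b)).
Proof.
move=> c rep; eexists; first exact: fexec_prim.
move=> j; case: eqP => [->|/eqP ne_j] /=.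
  have := tape_at_right (tape_at_write (bitcell b) (rep otape)).
  rewrite /contents /position /= eqxx size_rcons; congr tape_at.
  apply: functional_extensionality => -[|i] //=; rewrite eqSS map_rcons nth_rcons size_map.
  by case: ltngtP => // lt_i; rewrite nth_default // size_map ltnW.
have := rep j; rewrite /contents /position /=.
by rewrite (_ : (j == s.+1 :> nat) = false) //; apply: negPf; move: ne_j; rewrite ord_neq.
Qed.

Lemma does_while (i : 'I_s.+2) (P : pred (cell unit)) F (M : nat -> memory)
    (t : nat -> nat) e :
  (forall j, j < e -> P (contents (M j) i (position (M j) i)) /\
                      does F (M j) (t j) (M j.+1)) ->
  ~~ P (contents (M e) i (position (M e) i)) ->
  does (whileF i P F) (M 0) (\sum_(j < e) (t j).+2).+1 (M e).
Proof.
move=> H stop c rep.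
have [S [S0 SP]] : exists S : nat -> ('I_s.+2 -> tape unit), S 0 = c /\
   (forall j, j <= e -> represents (M j) (S j) /\
      (j < e -> fexec F (S j) (t j) (S j.+1))).
  elim: e M t H stop c rep => [|e IH] M t H stop c rep.
    by exists (fun=> c); split=> // -[].
  have [_ /(_ _ rep) [c1 run1 rep1]] := H 0 isT.
  have [] := IH (fun j => M j.+1) (fun j => t j.+1) _ stop c1 rep1.
    by move=> j lt_je; apply: H.
  move=> S [S0 SP]; exists (fun j => if j is j'.+1 then S j' else c); split=> //.
  case=> [|j] lt_je; first by split=> // _; rewrite S0.
  by have [] := SP j lt_je.
exists (S e); last by have [] := SP e (leqnn e).
rewrite -S0; apply: fexec_while => [j lt_je|].
  have [rep_j /(_ lt_je) run_j] := SP j (ltnW lt_je); split=> //.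
  by rewrite (tape_at_scanned (rep_j i)); have [] := H j lt_je.
have [rep_e _] := SP e (leqnn e).
by rewrite (tape_at_scanned (rep_e i)).
Qed.

Lemma does_loop v F (M : nat -> memory) (t : nat -> nat) e : v < s ->
  (forall j, j < e -> 0 < count (M j) v /\
     does F (setc (M j) v (count (M j) v).-1) (t j) (M j.+1)) ->
  count (M e) v = 0 ->
  does (loop v F) (M 0) (\sum_(j < e) (t j + 4)).+1 (M e).
Proof.
move=> lt_vs H stop.
have E m : contents m (ctape v) (position m (ctape v)) =
    if count m v == 0 then mark else None.
  rewrite /contents /position ctapeE //= eqSS ltn_eqF //=.
  by case: (count m v) => //= j; rewrite nth_nil.
apply: (does_le (t := (\sum_(j < e) (1 + t j).+3).+1)).
  by rewrite ltnS leq_sum // => j _; lia.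
apply: (does_while (t := fun j => (1 + t j).+1)); last by rewrite E stop eqxx.
move=> j lt_je; have [pos run] := H j lt_je.
split; first by rewrite E; case: (count _ _) pos.
by apply: does_seq run; apply: does_dec.
Qed.

Definition skipF : frag :=
  @Fragment _ _ unit tt predT (fun q v => (q, idle v)).

Lemma does_skip m : does skipF m 0 m.
Proof. by move=> c rep; exists c => //; exists 0, tt; split=> //; apply: frun0. Qed.

Definition clear (v : nat) : frag := loop v skipF.

(** A counter can be read only by running it down; [x] collects a copy from which [v] is restored,
    and is zero again at the end. *)
Definition add_to (v z x : nat) : frag :=
  seqF (loop v (seqF (inc z) (inc x))) (loop x (inc v)).

Lemma does_clear v m : v < s -> does (clear v) m (4 * count m v).+1 (setc m v 0).
Proof.
move=> lt_vs; set e := count m v.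
pose M j := setc m v (e - j).
have E0 : M 0 = m.
  rewrite /M /setc subn0 /e; case: (m) => p f o /=; congr Memory.
  by apply: functional_extensionality => i; rewrite /upd; case: eqP => // ->.
have Ee : M e = setc m v 0 by rewrite /M subnn.
rewrite -Ee -{1}E0.
apply: (does_le _ (@does_loop v _ M (fun=> 0) e lt_vs _ _)).
- by rewrite sum_nat_const card_ord; lia.
- move=> j lt_je; rewrite /M /= /upd eqxx; split; first by lia.
  set m' := setc _ _ _; suff -> : m' = setc m v (e - j.+1) by apply: does_skip.
  rewrite /m' /setc /=; congr Memory.
  by apply: functional_extensionality => i; rewrite /upd; case: eqP => // _; lia.
- by rewrite /M /= /upd eqxx subnn.
Qed.

Lemma does_add_to v z x m : v < s -> z < s -> x < s ->
    v != z -> v != x -> z != x -> count m x = 0 ->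
  does (add_to v z x) m (12 * count m v + 3) (setc m z (count m z + count m v)).
Proof.
case: m => p f o /= lt_v lt_z lt_x /eqP ne_vz /eqP ne_vx /eqP ne_zx fx0.
set e := f v.
pose M1 j := Memory p (upd (upd (upd f v (e - j)) z (f z + j)) x j) o.
pose M2 j := Memory p (upd (upd (upd f v j) z (f z + e)) x (e - j)) o.
have -> : Memory p f o = M1 0.
  by rewrite /M1 subn0 addn0; mem_eq.
have -> : setc (M1 0) z (f z + e) = M2 e by rewrite /M1 /M2 subnn; mem_eq.
apply: (does_le (t := ((7 * e).+1 + (5 * e).+1).+1)); first by lia.
apply: (does_seq (m' := M2 0)).
  have -> : M2 0 = M1 e by rewrite /M1 /M2 subnn subn0.
  apply: (does_le _ (@does_loop v _ M1 (fun=> 3) e lt_v _ _)).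
  - by rewrite sum_nat_const card_ord; lia.
  - move=> j lt_je; rewrite /M1 /=; split.
      by rewrite /upd; repeat (case: eqP => ? //); lia.
    apply: (does_seq (t := 1) (t' := 1)); first exact: does_inc.
    set m1 := setc _ _ _; rewrite (_ : Memory _ _ _ = setc m1 x (count m1 x).+1).
      exact: does_inc.
    by rewrite /m1; mem_eq.
  - by rewrite /M1 /= /upd; repeat (case: eqP => ? //); lia.
apply: (does_le _ (@does_loop x _ M2 (fun=> 1) e lt_x _ _)).
- by rewrite sum_nat_const card_ord; lia.
- move=> j lt_je; rewrite /M2 /=; split.
    by rewrite /upd eqxx; lia.
  set m1 := setc _ _ _; rewrite (_ : Memory _ _ _ = setc m1 v (count m1 v).+1).
    exact: does_inc.
  by rewrite /m1; mem_eq.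
- by rewrite /M2 /= /upd eqxx subnn.
Qed.

(** Between commands the counters from [d] on are zero and the input head is on cell 0. [IfBit]
    restores this inside both branches, since only the control state remembers the outcome of the
    test. *)
Fixpoint compile (d : nat) (g : program) : frag :=
  match g with
  | Skip => skipF
  | Emit b => emit b
  | Seq g1 g2 => seqF (compile d g1) (compile d g2)
  | For v g1 =>
      seqF (add_to v d.+1 d)
        (seqF (loop d.+1 (seqF (compile d.+2 g1) (inc d))) (clear d))
  | IfBit v g1 g2 =>
      let restore := loop d (seqF (inc v) (move ord0 Left)) in
      seqF (loop v (seqF (inc d) (move ord0 Right)))
        (ifF ord0 (fun a => a == bitcell true)
          (seqF restore (compile d g1)) (seqF restore (compile d g2)))
  | LetC e g1 =>
      seqF (iter e (fun F => seqF F (inc d)) skipF)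
        (seqF (compile d.+1 g1) (clear d))
  | LetAdd a b g1 =>
      seqF (seqF (add_to a d d.+1) (add_to b d d.+1))
        (seqF (compile d.+1 g1) (clear d))
  | LetMul a b g1 =>
      seqF (seqF (add_to a d.+1 d.+2) (loop d.+1 (add_to b d d.+2)))
        (seqF (compile d.+1 g1) (clear d))
  end.

(** An upper bound on the running time, charging both branches of a test. Every emitted bit costs a
    step, so it bounds the output length as well. *)
Fixpoint cost (env : seq nat) (g : program) : nat :=
  let val v := nth 0 env v in
  match g with
  | Skip => 0
  | Emit b => 1
  | Seq g1 g2 => (cost env g1 + cost env g2).+1
  | For v g1 =>
      \sum_(i < val v) (cost (env ++ [:: nat_of_ord i; val v - i.+1]) g1) +
      22 * val v + 10
  | IfBit v g1 g2 => 14 * val v + 10 + cost env g1 + cost env g2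
  | LetC e g1 => 6 * e + 5 + cost (rcons env e) g1
  | LetAdd a b g1 => 16 * (val a + val b) + 15 + cost (rcons env (val a + val b)) g1
  | LetMul a b g1 =>
      16 * (val a * val b) + 19 * val a + 15 + cost (rcons env (val a * val b)) g1
  end.

Definition env_memory (env : seq nat) (o : seq bool) : memory :=
  Memory 0 (nth 0 env) o.

Lemma nth_rcons_upd env x : nth 0 (rcons env x) = upd (nth 0 env) (size env) x.
Proof.
apply: functional_extensionality => i; rewrite nth_rcons /upd.
by case: ltngtP => // lt_i; rewrite nth_default // ltnW.
Qed.

Lemma env_memory_rcons env x o :
  env_memory (rcons env x) o = setc (env_memory env o) (size env) x.
Proof. by rewrite /env_memory nth_rcons_upd. Qed.

Lemma does_let env e o o' F t : size env < s ->
  does F (env_memory (rcons env e) o) t (env_memory (rcons env e) o') ->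
  does (seqF F (clear (size env))) (setc (env_memory env o) (size env) e)
    (t + (4 * e).+1).+1 (env_memory env o').
Proof.
move=> lt_s run; apply: (does_seq (m' := env_memory (rcons env e) o')).
  by rewrite -env_memory_rcons.
have := @does_clear (size env) (env_memory (rcons env e) o') lt_s.
rewrite /= nth_rcons ltnn eqxx; congr does; rewrite env_memory_rcons.
rewrite /env_memory; mem_eq.
by rewrite nth_default.
Qed.

Lemma does_compile g d env o : d = size env -> scoped d g -> width d g <= s ->
  does (compile d g) (env_memory env o) (cost env g)
    (env_memory env (o ++ exec w env g)).
Proof.
elim: g d env o => /=.
- by move=> d env o _ _ _; rewrite cats0; apply: does_skip.
- by move=> b d env o _ _ _; rewrite cats1; apply: does_emit.
- move=> g1 IH1 g2 IH2 d env o Ed /andP[s1 s2]; rewrite geq_max => /andP[w1 w2].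
  by rewrite catA; apply: does_seq; [apply: IH1 | apply: IH2].
- move=> v g IH d env o Ed /andP[lt_vd sg]; rewrite geq_max => /andP[lt_ds wg].
  set e := nth 0 env v.
  set S := \sum_(i < e) _.
  apply: (does_le (t := ((12 * e + 3) +
     ((\sum_(i < e) ((cost (env ++ [:: nat_of_ord i; e - i.+1]) g + 1).+1 + 4)).+1 + (4 * e).+1).+1).+1)).
    rewrite (eq_bigr (fun i : 'I_e => cost (env ++ [:: nat_of_ord i; e - i.+1]) g + 6)); last by move=> i _; lia.
    by rewrite big_split /= sum_nat_const card_ord -/S; lia.
  pose M j := setc (setc (env_memory env
    (o ++ flatten [seq exec w (env ++ [:: i; e - i.+1]) g | i <- iota 0 j])) d j) d.+1 (e - j).
  apply: (does_seq (m' := M 0)).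
    have -> : M 0 = setc (env_memory env o) d.+1
        (count (env_memory env o) d.+1 + count (env_memory env o) v).
      rewrite /M /= cats0 subn0; mem_eq; last by rewrite nth_default //; lia.
      by rewrite nth_default //; lia.
    by apply: does_add_to; rewrite ?neq_ltn ?Ed ?ltnSn ?orbT //=; try lia; rewrite nth_default.
  apply: (does_seq (m' := M e)).
    apply: (@does_loop d.+1 _ M (fun i => (cost (env ++ [:: i; e - i.+1]) g + 1).+1) e).
    + by lia.
    + move=> j lt_je; split; first by rewrite /M /= /upd eqxx; lia.
      have Eenv o' : env_memory (env ++ [:: j; e - j.+1]) o' =
          setc (setc (env_memory env o') d j) d.+1 (e - j.+1).
        by rewrite -cat_rcons -cat_rcons cats0 env_memory_rcons size_rcons env_memory_rcons Ed.
      set m1 := setc _ _ _.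
      have {m1} -> : m1 = env_memory (env ++ [:: j; e - j.+1])
         (o ++ flatten [seq exec w (env ++ [:: i; e - i.+1]) g | i <- iota 0 j]).
        by rewrite Eenv /m1 /M; mem_eq.
      apply: does_seq; first by apply: IH; rewrite ?size_cat /= ?Ed ?addn2 // -Ed.
      rewrite Eenv; set m1 := setc _ _ _.
      have -> : M j.+1 = setc m1 d (count m1 d).+1.
        rewrite /m1 /M -(addn1 j) iotaD map_cat flatten_cat /= cats0 add0n addn1 catA.
        by mem_eq.
      by apply: does_inc; lia.
    + by rewrite /M /= /upd eqxx subnn.
  have {2}-> : e = count (M e) d by rewrite /M /= /upd eqxx; case: eqP => //; lia.
  set m1 := env_memory _ _.
  have -> : m1 = setc (M e) d 0.
    rewrite /m1 /M /env_memory subnn; mem_eq; rewrite nth_default //; lia.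
  by apply: does_clear; lia.
- move=> v g1 IH1 g2 IH2 d env o Ed /and3P[lt_vd s1 s2].
  rewrite !geq_max => /and3P[lt_ds w1 w2]; set e := nth 0 env v.
  apply: (does_le (t := ((7 * e).+1 + (7 * e + 1 +
     (cost env g1 + cost env g2) + 2).+1).+1)); first by lia.
  (* Counter [d] remembers how far the input head has moved, so the same family traversed backwards
     describes the return. *)
  pose M j := Memory j (upd (upd (nth 0 env) v (e - j)) d j) o.
  have M0 : M 0 = env_memory env o.
    by rewrite /M /env_memory subn0; mem_eq; rewrite nth_default.
  apply: (does_seq (m' := M e)).
    rewrite -M0; apply: (does_le _ (@does_loop v _ M (fun=> 3) e _ _ _)).
    + by rewrite sum_nat_const card_ord; lia.
    + by lia.
    + move=> j lt_je; split; first by rewrite /M /upd /= eqxx; case: eqP; lia.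
      apply: (does_seq (t := 1) (t' := 1)); first by apply: does_inc; lia.
      set m1 := setc _ _ _.
      have -> : M j.+1 = Memory (inpos m1).+1 (count m1) (written m1).
        by rewrite /m1 /M; mem_eq.
      exact: does_input_right.
    + by rewrite /M /upd /= eqxx; case: eqP; lia.
  have restore : does (loop d (seqF (inc v) (move ord0 Left))) (M e)
      (7 * e + 1) (env_memory env o).
    pose M' j := M (e - j).
    have -> : M e = M' 0 by rewrite /M' subn0.
    have -> : env_memory env o = M' e by rewrite /M' subnn.
    apply: (does_le _ (@does_loop d _ M' (fun=> 3) e _ _ _)).
    + by rewrite sum_nat_const card_ord; lia.
    + by lia.
    + move=> j lt_je; split; first by rewrite /M' /M /upd /= eqxx; lia.
      apply: (does_seq (t := 1) (t' := 1)); first by apply: does_inc; lia.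
      set m1 := setc _ _ _.
      have -> : M' j.+1 = Memory (e - j.+1) (count m1) (written m1).
        by rewrite /m1 /M' /M; mem_eq.
      have -> : m1 = Memory (e - j.+1).+1 (count m1) (written m1).
        by rewrite /m1 /M' /M /=; congr Memory => /=; lia.
      exact: does_input_left.
    + by rewrite /M' /M /upd /= eqxx subnn.
  move=> c rep.
  have Hbit : (scanned (c ord0) == bitcell true) = nth false w e.
    rewrite (tape_at_scanned (rep ord0)) /contents /position /=.
    (* Beyond the input the cell is blank, which the test treats like the default bit [false]. *)
    case: (ltnP e (size w)) => [lt_ew|le_we]; last by rewrite !nth_default ?size_map.
    by rewrite (nth_map false) //; case: (nth _ _ _).
  have [c' run rep'] : exists2 c', fexec (if scanned (c ord0) == bitcell true then
      seqF (loop d (seqF (inc v) (move ord0 Left))) (compile d g1) else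
      seqF (loop d (seqF (inc v) (move ord0 Left))) (compile d g2)) c
         (7 * e + 1 + (cost env g1 + cost env g2) + 2) c' &
     represents (env_memory env (o ++ (if nth false w e then exec w env g1 else exec w env g2))) c'.
    rewrite Hbit; case: nth.
      apply: (does_le _ (does_seq restore (IH1 _ _ _ Ed s1 w1))) rep; lia.
    apply: (does_le _ (does_seq restore (IH2 _ _ _ Ed s2 w2))) rep; lia.
  by exists c' => //; apply: (fexec_if (P := fun a => a == bitcell true)).
- move=> e g IH d env o Ed sg; rewrite geq_max => /andP[lt_ds wg].
  apply: (does_le (t := (2 * e + (cost (rcons env e) g + (4 * e).+1).+1).+1)); first by lia.
  apply: (does_seq (m' := setc (env_memory env o) d e)); last first.
    by rewrite Ed; apply: does_let; rewrite -?Ed //; apply: IH; rewrite ?size_rcons ?Ed // -Ed.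
  elim: e => [|e IHe].
    have -> : setc (env_memory env o) d 0 = env_memory env o.
      by rewrite /env_memory; mem_eq; rewrite nth_default.
    exact: does_skip.
  rewrite [iter _ _ _]iterS; apply: (does_le (t := (2 * e + 1).+1)); first by lia.
  apply: (does_seq IHe); set m1 := setc _ _ _.
  have -> : setc (env_memory env o) d e.+1 = setc m1 d (count m1 d).+1 by rewrite /m1; mem_eq.
  exact: does_inc.
- move=> a b g IH d env o Ed /and3P[lt_ad lt_bd sg].
  rewrite geq_max => /andP[lt_ds wg].
  set x := nth 0 env a; set y := nth 0 env b.
  apply: (does_le (t := ((12 * x + 3 + (12 * y + 3)).+1 +
     (cost (rcons env (x + y)) g + (4 * (x + y)).+1).+1).+1)); first by lia.
  apply: (does_seq (m' := setc (env_memory env o) d (x + y))); last first.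
    by rewrite Ed; apply: does_let; rewrite -?Ed; [lia|apply: IH; rewrite ?size_rcons ?Ed // -Ed].
  apply: (does_seq (m' := setc (env_memory env o) d x)).
    have {2}-> : x = count (env_memory env o) d + count (env_memory env o) a.
      by rewrite /= [nth 0 env d]nth_default // Ed.
    by apply: does_add_to; rewrite /= ?[nth 0 env d.+1]nth_default; try lia.
  set m1 := setc _ _ _.
  have -> : setc (env_memory env o) d (x + y) = setc m1 d (count m1 d + count m1 b).
    by rewrite /m1; mem_eq.
  have -> : y = count m1 b by rewrite /m1 /= /upd; case: eqP => //; lia.
  apply: does_add_to; try lia.
  by rewrite /m1 /= /upd; case: eqP => [|_]; [lia|rewrite nth_default //; lia].
- move=> a b g IH d env o Ed /and3P[lt_ad lt_bd sg].
  rewrite geq_max => /andP[lt_ds wg].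
  set x := nth 0 env a; set y := nth 0 env b.
  apply: (does_le (t := ((12 * x + 3 + (x * (12 * y + 7)).+1).+1 +
     (cost (rcons env (x * y)) g + (4 * (x * y)).+1).+1).+1)); first by lia.
  apply: (does_seq (m' := setc (env_memory env o) d (x * y))); last first.
    by rewrite Ed; apply: does_let; rewrite -?Ed; [lia|apply: IH; rewrite ?size_rcons ?Ed // -Ed].
  pose M j := setc (setc (env_memory env o) d.+1 (x - j)) d (j * y).
  apply: (does_seq (m' := M 0)).
    have -> : M 0 = setc (env_memory env o) d.+1
        (count (env_memory env o) d.+1 + count (env_memory env o) a).
      by rewrite /M subn0 mul0n /=; mem_eq; rewrite nth_default //; lia.
    by apply: does_add_to; rewrite /= ?[nth 0 env d.+2]nth_default; try lia.
  have -> : setc (env_memory env o) d (x * y) = M x.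
    by rewrite /M subnn; mem_eq; rewrite nth_default //; lia.
  apply: (does_le _ (@does_loop d.+1 _ M (fun=> 12 * y + 3) x _ _ _)).
  + by rewrite sum_nat_const card_ord; lia.
  + by lia.
  + move=> j lt_jx; split; first by rewrite /M /= /upd; case: eqP => [|_]; rewrite ?eqxx; lia.
    set m1 := setc _ _ _.
    have -> : M j.+1 = setc m1 d (count m1 d + count m1 b).
      by rewrite /m1 /M mulSn; mem_eq; rewrite -/y; lia.
    have -> : y = count m1 b.
      by rewrite /m1 /M /= /upd; repeat (case: eqP => [|_]; first lia).
    apply: does_add_to; try lia.
    rewrite /m1 /M /= /upd; repeat (case: eqP => [|_]; first lia).
    by rewrite nth_default //; lia.
  + by rewrite /M /= /upd; case: eqP => [|_]; rewrite ?eqxx; lia.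
Qed.

End Compile.

(** * Polynomial bounds *)

Lemma leq_exp2r_w m n c : m <= n -> m ^ c <= n ^ c.
Proof. by case: c => // c; rewrite leq_exp2r. Qed.

(** The base is at least 2, so constants and constant factors are absorbed by raising the exponent,
    also for small [n]. *)
Definition poly_bounded (f : nat -> nat) : Prop :=
  exists c, forall n, f n <= n.+2 ^ c.

Lemma poly_bounded_id : poly_bounded id.
Proof. by exists 1 => n; rewrite expn1; lia. Qed.

Lemma poly_bounded_const c : poly_bounded (fun=> c).
Proof.
exists c => n; apply: leq_trans (ltnW (ltn_expl c (isT : 1 < 2))) _.
exact: leq_exp2r_w.
Qed.

Lemma poly_boundedM f g : poly_bounded f -> poly_bounded g ->
  poly_bounded (fun n => f n * g n).
Proof. by case=> c le_f [d le_g]; exists (c + d) => n; rewrite expnD leq_mul. Qed.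

Lemma poly_boundedD f g : poly_bounded f -> poly_bounded g ->
  poly_bounded (fun n => f n + g n).
Proof.
case=> c le_f [d le_g]; exists (maxn c d).+1 => n.
have le_c : n.+2 ^ c <= n.+2 ^ maxn c d by rewrite leq_exp2l ?leq_maxl.
have le_d : n.+2 ^ d <= n.+2 ^ maxn c d by rewrite leq_exp2l ?leq_maxr.
have := le_f n; have := le_g n; rewrite expnS; nia.
Qed.

Lemma poly_bounded_comp f g : poly_bounded f -> poly_bounded g ->
  poly_bounded (f \o g).
Proof.
(* With N = n + 2, the argument passed to the bound of [f] is at most N^d + 2, hence at most
   N^(d+2). *)
case=> c le_f [d le_g]; exists (d.+2 * c) => n /=.
apply: leq_trans (le_f _) _; rewrite expnM; apply: leq_exp2r_w.
have := le_g n; have : 0 < n.+2 ^ d by rewrite expn_gt0.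
by rewrite !expnS; nia.
Qed.

Lemma poly_bounded_le f : poly_bounded f -> exists c, forall n, f n <= n ^ c + c.
Proof.
(* For n at least 2, n + 2 is at most n^2; the constant 3^c takes care of n = 0 and n = 1. *)
case=> c le_f; exists (2 * c + 3 ^ c) => n; apply: leq_trans (le_f n) _.
case: (leqP n 1) => [le_n1|lt_1n].
  have : n.+2 ^ c <= 3 ^ c by apply: leq_exp2r_w.
  lia.
apply: leq_trans (leq_addr _ _); apply: (leq_trans (n := n ^ (2 * c))).
  by rewrite expnM; apply: leq_exp2r_w; nia.
by rewrite leq_exp2l // leq_addr.
Qed.

Lemma size_exec w env g : size (exec w env g) <= cost env g.
Proof.
elim: g env => //=.
- by move=> g1 IH1 g2 IH2 env; rewrite size_cat leqW // leq_add.
- move=> v g IH env; rewrite size_flatten /shape -map_comp sumnE big_map.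
  rewrite -{1}[nth 0 env v]subn0 -/(index_iota 0 _) big_mkord.
  do 2!apply: leq_trans (leq_addr _ _); apply: leq_sum => i _; exact: IH.
- move=> v g1 IH1 g2 IH2 env; have := IH1 env; have := IH2 env.
  by case: ifP => _; lia.
- by move=> e g IH env; apply: leq_trans (IH _) (leq_addl _ _).
- by move=> a b g IH env; apply: leq_trans (IH _) (leq_addl _ _).
- by move=> a b g IH env; apply: leq_trans (IH _) (leq_addl _ _).
Qed.

(** Loop variables stay below the bound [B] of the environment; only the let constructs enlarge it,
    each by a fixed polynomial. Evaluating [P] at the enlarged bound itself avoids any monotonicity
    requirement. *)
Lemma cost_poly_bounded g : exists2 P, poly_bounded P &
  forall B env, (forall v, nth 0 env v <= B) -> cost env g <= P B.
Proof.
have le_rcons env x B : (forall v, nth 0 env v <= B) ->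
    forall v, nth 0 (rcons env x) v <= B + x.
  move=> le_B v; rewrite nth_rcons; case: ltnP => _; first by have := le_B v; lia.
  by case: eqP; lia.
elim: g => /=.
- by exists (fun=> 0) => //; apply: poly_bounded_const.
- by move=> b; exists (fun=> 1) => //; apply: poly_bounded_const.
- move=> g1 [P pP le_P] g2 [Q pQ le_Q].
  exists (fun B => P B + Q B + 1).
    by apply: poly_boundedD (poly_bounded_const 1); apply: poly_boundedD.
  by move=> B env le_B; have := le_P _ _ le_B; have := le_Q _ _ le_B; lia.
- move=> v g [P pP le_P]; exists (fun B => B * P B + (22 * B + 10)).
    apply: poly_boundedD; first exact: poly_boundedM poly_bounded_id pP.
    apply: poly_boundedD (poly_bounded_const 10).
    exact: poly_boundedM (poly_bounded_const 22) poly_bounded_id.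
  move=> B env le_B; have le_v := le_B v.
  suff : \sum_(i < nth 0 env v)
      cost (env ++ [:: nat_of_ord i; nth 0 env v - i.+1]) g <= nth 0 env v * P B.
    by set S := \sum_(i < _) _; move=> le_S; have := leq_mul le_v (leqnn (P B)); lia.
  have -> : nth 0 env v * P B = \sum_(i < nth 0 env v) P B.
    by rewrite sum_nat_const card_ord.
  apply: leq_sum => i _.
  apply: le_P => u; rewrite nth_cat; case: ltnP => // _; case: (u - _) => [|[|k]] /=.
  - by have := ltn_ord i; lia.
  - by lia.
  - by rewrite nth_nil.
- move=> v g1 [P pP le_P] g2 [Q pQ le_Q].
  exists (fun B => 14 * B + 10 + P B + Q B).
    apply: poly_boundedD pQ; apply: poly_boundedD pP.
    apply: poly_boundedD (poly_bounded_const 10).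
    exact: poly_boundedM (poly_bounded_const 14) poly_bounded_id.
  move=> B env le_B; have := le_P _ _ le_B; have := le_Q _ _ le_B; have := le_B v; lia.
- move=> e g [P pP le_P]; exists (fun B => 6 * e + 5 + P (B + e)).
    apply: poly_boundedD (poly_bounded_const _) _.
    apply: (poly_bounded_comp pP); apply: poly_boundedD poly_bounded_id (poly_bounded_const _).
  by move=> B env le_B; rewrite leq_add2l; apply: le_P; apply: le_rcons.
- move=> a b g [P pP le_P]; exists (fun B => 32 * B + 15 + P (B + (B + B))).
    apply: poly_boundedD.
      apply: poly_boundedD (poly_bounded_const 15).
      exact: poly_boundedM (poly_bounded_const 32) poly_bounded_id.
    apply: (poly_bounded_comp pP).
    by do !apply: poly_boundedD; apply: poly_bounded_id.
  move=> B env le_B; have la := le_B a; have lb := le_B b.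
  apply: leq_add; first by lia.
  apply: le_P => v; apply: leq_trans (le_rcons _ _ _ le_B v) _; lia.
- move=> a b g [P pP le_P].
  exists (fun B => 16 * (B * B) + 19 * B + 15 + P (B + B * B)).
    apply: poly_boundedD.
      apply: poly_boundedD (poly_bounded_const 15); apply: poly_boundedD.
        apply: poly_boundedM (poly_bounded_const 16) _.
        exact: poly_boundedM poly_bounded_id poly_bounded_id.
      exact: poly_boundedM (poly_bounded_const 19) poly_bounded_id.
    apply: (poly_bounded_comp pP); apply: poly_boundedD poly_bounded_id _.
    exact: poly_boundedM poly_bounded_id poly_bounded_id.
  move=> B env le_B; have la := le_B a; have lb := le_B b.
  have lab : nth 0 env a * nth 0 env b <= B * B by apply: leq_mul.
  apply: leq_add; first by lia.
  apply: le_P => v; apply: leq_trans (le_rcons _ _ _ le_B v) _; lia.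
Qed.

(** * Programs run in polynomial time *)

Section Startup.
Variables (s : nat) (w : seq bool).
Notation bitcell b := (Some (inl b) : cell unit).
Notation mark := (Some (inr tt) : cell unit).
Notation frag := (fragment s.+2 unit).

Definition mark_tapes : frag :=
  @Fragment _ _ bool false id (fun _ v => (true, fun i =>
    if i == ord0 then (v i, Stay)
    else (mark, if i == otape s then Right else Stay))).

(** Counting to the first blank leaves the input head at the far end; counter 0 is then moved to
    counter 1 to bring the head back, and copied back. *)
Definition measure : frag :=
  seqF (whileF ord0 (fun a => a != None) (seqF (inc s 0) (move ord0 Right)))
    (seqF (loop 0 (seqF (inc s 1) (move ord0 Left))) (loop 1 (inc s 0))).

Definition rewind : frag :=
  seqF (whileF (otape s) (fun a => a != mark) (move (otape s) Left))
    (move (otape s) Right).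

Lemma fexec_mark_tapes : exists2 c,
  fexec mark_tapes (fun i => tape_of_word unit (if i == ord0 then w else [::])) 1 c &
  represents w (env_memory [::] [::]) c.
Proof.
eexists; first by exists 1, true; split=> //; apply: frunS => //=; apply: frun0.
move=> i; rewrite /act_on /heads /= ffunE; case: eqP => [->|/eqP ne_i].
  by rewrite (write_scanned (tape_of_word unit w)); apply: tape_at_init.
rewrite /contents /position /= (negPf (ne_i : i != 0 :> nat)).
have wr : tape_at (nth None [:: mark]) 0 (write mark (tape_of_word unit [::])).
  by split=> -[|[|j]].
rewrite (_ : (i == otape s) = (i == s.+1 :> nat)) //.
case: eqP => _; first exact: tape_at_right.
by rewrite nth_nil.
Qed.

Lemma does_measure : 1 < s ->
  does w measure (env_memory [::] [::]) (26 * size w + 5) (env_memory [:: size w] [::]).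
Proof.
move=> gt1_s; set n := size w.
have lt0s : 0 < s := ltnW gt1_s.
pose M1 j := @Memory j (upd (fun=> 0) 0 j) [::].
pose M2 j := @Memory (n - j) (upd (upd (fun=> 0) 0 (n - j)) 1 j) [::].
pose M3 j := @Memory 0 (upd (upd (fun=> 0) 0 j) 1 (n - j)) [::].
have -> : env_memory [::] [::] = M1 0.
  by rewrite /M1 /env_memory; mem_eq; rewrite nth_nil.
have -> : env_memory [:: n] [::] = M3 n.
  by rewrite /M3 /env_memory subnn; mem_eq; rewrite nth_default //=; lia.
apply: (does_le (t := ((5 * n).+1 + ((7 * n).+1 + (5 * n).+1).+1).+1)); first by lia.
apply: (does_seq (m' := M1 n)).
  apply: (does_le _ (@does_while _ w ord0 (fun a => a != None) _ M1 (fun=> 3) n _ _)).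
  - by rewrite sum_nat_const card_ord; lia.
  - move=> j lt_jn; split.
      by rewrite /contents /position /= (nth_map false).
    apply: (does_seq (t := 1) (t' := 1)); first by apply: does_inc.
    set m1 := setc _ _ _.
    have -> : M1 j.+1 = Memory (inpos m1).+1 (count m1) (written m1).
      by rewrite /m1 /M1; mem_eq.
    exact: does_input_right.
  - by rewrite /contents /position /= nth_default // size_map.
have -> : M1 n = M2 0 by rewrite /M1 /M2 subn0; mem_eq.
apply: (does_seq (m' := M2 n)).
  apply: (does_le _ (@does_loop _ w 0 _ M2 (fun=> 3) n _ _ _)) => //.
  - by rewrite sum_nat_const card_ord; lia.
  - move=> j lt_jn; split; first by rewrite /M2 /= /upd /=; lia.
    apply: (does_seq (t := 1) (t' := 1)); first by apply: does_inc.
    set m1 := setc _ _ _.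
    have -> : M2 j.+1 = Memory (n - j.+1) (count m1) (written m1).
      by rewrite /m1 /M2; mem_eq.
    have -> : m1 = Memory (n - j.+1).+1 (count m1) (written m1).
      by rewrite /m1 /M2 /=; congr Memory => /=; lia.
    exact: does_input_left.
  - by rewrite /M2 /= /upd /= subnn.
have -> : M2 n = M3 0 by rewrite /M2 /M3 subnn subn0; mem_eq.
apply: (does_le _ (@does_loop _ w 1 _ M3 (fun=> 1) n _ _ _)) => //.
- by rewrite sum_nat_const card_ord; lia.
- move=> j lt_jn; split; first by rewrite /M3 /= /upd /=; lia.
  set m1 := setc _ _ _.
  have -> : M3 j.+1 = setc m1 0 (count m1 0).+1 by rewrite /m1 /M3; mem_eq.
  exact: does_inc.
- by rewrite /M3 /= /upd /= subnn.
Qed.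

Lemma fexec_rewind m c : represents w m c -> exists2 c',
  fexec rewind c (3 * size (written m) + 6) c' &
  tape_at (contents s w m s.+1) 1 (c' (otape s)).
Proof.
move=> rep; set p := (size (written m)).+1.
pose S j i := if i == otape s then iter j (shift Left) (c i) else c i.
have repS j : j <= p -> tape_at (contents s w m s.+1) (p - j) (S j (otape s)).
  rewrite /S eqxx; elim: j => [|j IH] le_jp.
    by have := rep (otape s); rewrite subn0 /position /= eqxx.
  apply: tape_at_left; rewrite (_ : (p - j.+1).+1 = p - j); last by lia.
  by apply: IH; lia.
have E1 : fexec (whileF (otape s) (fun a => a != mark) (move (otape s) Left)) c
    (\sum_(j < p) 3).+1 (S p).
  have {1}<- : S 0 = c by apply: functional_extensionality => i; rewrite /S if_same.
  apply: (fexec_while (P := fun a => a != mark) (t := fun=> 1)).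
    move=> j lt_jp; split.
      rewrite (tape_at_scanned (repS _ (ltnW lt_jp))) /contents /= eqxx.
      rewrite (_ : p - j = (p - j.+1).+1) /=; last by lia.
      case: (ltnP (p - j.+1) (size (written m))) => lt_i.
        by rewrite (nth_map false).
      by rewrite nth_default // size_map.
    have := fexec_prim (otape s) (fun a => (a, Left)) (S j); congr fexec.
    apply: functional_extensionality => i; rewrite /S.
    by case: eqP => // _; rewrite write_scanned.
  by rewrite (tape_at_scanned (repS _ (leqnn _))) subnn /contents /=.
eexists.
  have [k [q [le_k run halt]]] := fexec_seq E1 (fexec_prim (otape s) (fun a => (a, Right)) (S p)).
  exists k, q; split; [|exact: run|exact: halt].
  by apply: leq_trans le_k _; rewrite sum_nat_const card_ord /p; lia.
rewrite /= eqxx; apply: (@tape_at_right _ _ 0 (S p (otape s))).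
by rewrite -(subnn p); apply: repS.
Qed.

End Startup.

Theorem polytime_exec g : scoped 1 g -> polytime (fun w => exec w [:: size w] g).
Proof.
(* [measure] needs two counters whatever the program uses. *)
move=> sc_g; pose s := maxn 2 (width 1 g).
have gt1_s : 1 < s by rewrite leq_max.
have le_s : width 1 g <= s by rewrite leq_max leqnn orbT.
have [P pP le_P] := cost_poly_bounded g.
(* The summand 26n pays for [measure]. Of the four copies of [P n], one is for the program and three
   for rewinding over its output, which is no longer than its cost. *)
have pQ : poly_bounded (fun n => 26 * n + (4 * P n + 30)).
  apply: poly_boundedD; first exact: poly_boundedM (poly_bounded_const _) poly_bounded_id.
  apply: poly_boundedD (poly_bounded_const _); exact: poly_boundedM (poly_bounded_const _) pP.
have [c le_c] := poly_bounded_le pQ.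
pose F := seqF (mark_tapes s) (seqF (measure s) (seqF (compile s 1 g) (rewind s))).
exists c; exists (machine_of F) => w.
have [c1 run1 rep1] := fexec_mark_tapes s w.
have [c2 run2 rep2] := does_measure gt1_s rep1.
have [c3 run3 rep3] := does_compile (erefl : 1 = size [:: size w]) sc_g le_s rep2.
have [c4 run4 tape4] := fexec_rewind rep3.
have [k [q [le_k run_k halt]]] := fexec_seq run1 (fexec_seq run2 (fexec_seq run3 run4)).
have Erun : run (machine_of F) w k = @Config (machine_of F) q c4 := frun_machine run_k.
exists k; rewrite Erun; split=> //.
  have le_g := le_P (size w) [:: size w] _.
  have {}le_g : cost [:: size w] g <= P (size w).
    by apply: le_g => -[|[|v]].
  have le_sz := size_exec w [:: size w] g.
  apply: leq_trans (le_c _); apply: leq_trans le_k _.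
  by move: le_g le_sz; rewrite /=; lia.
have [_ Ht] := tape4; rewrite -[RHS](leading_bits_word unit).
by apply: (@leading_bits_nth unit) => j; rewrite Ht /contents eqxx.
Qed.

(** * A program printing the reduction *)

Lemma unary_cat s t : unary (s ++ t) = unary s ++ unary t.
Proof. by rewrite /unary map_cat flatten_cat. Qed.

Lemma unary_flatten (T : Type) (f : T -> seq nat) s :
  unary (flatten [seq f x | x <- s]) = flatten [seq unary (f x) | x <- s].
Proof. by elim: s => //= x s IH; rewrite unary_cat IH. Qed.

Definition print_bits (s : seq bool) : program := foldr (fun b => Seq (Emit b)) Skip s.
Definition print (s : seq nat) : program := print_bits (unary s).
Definition print_var (c v : nat) : program :=
  Seq (print_bits (nseq c true)) (Seq (For v (Emit true)) (Emit false)).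

Lemma scoped_print_bits d s : scoped d (print_bits s).
Proof. by elim: s. Qed.

Lemma exec_print_bits w env s : exec w env (print_bits s) = s.
Proof. by elim: s => //= b s ->. Qed.

Lemma exec_print w env s : exec w env (print s) = unary s.
Proof. exact: exec_print_bits. Qed.

Lemma exec_seq w env g1 g2 s1 s2 :
  exec w env g1 = unary s1 -> exec w env g2 = unary s2 ->
  exec w env (Seq g1 g2) = unary (s1 ++ s2).
Proof. by move=> E1 E2; rewrite unary_cat -E1 -E2. Qed.

Lemma exec_for w env v e g (f : nat -> seq nat) : nth 0 env v = e ->
  (forall i, i < e -> exec w (env ++ [:: i; e - i.+1]) g = unary (f i)) ->
  exec w env (For v g) = unary (flatten [seq f i | i <- iota 0 e]).
Proof.
move=> /= -> Eg; rewrite unary_flatten; congr flatten; apply/eq_in_map => i.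
by rewrite mem_iota; apply: Eg.
Qed.

Lemma exec_repeat w env v e g s : nth 0 env v = e ->
  (forall i, i < e -> exec w (env ++ [:: i; e - i.+1]) g = unary s) ->
  exec w env (For v g) = unary (flatten (nseq e s)).
Proof.
move=> Ev Eg; rewrite (exec_for Ev Eg) (@map_const_in _ _ _ s) ?size_iota //.
Qed.

Lemma exec_print_var w env c v : exec w env (print_var c v) = unary [:: c + nth 0 env v].
Proof.
rewrite /print_var /= exec_print_bits /unary /= cats0 nseqD -cats1 -catA; congr (_ ++ (_ ++ _)).
by rewrite (@map_const_in _ _ _ [:: true]) ?size_iota //=; elim: (nth _ _ _) => //= ? ->.
Qed.

Section Printer.
Variables (M : machine) (k : nat).

(** The two variables of the enclosing loop over [j] are exactly the repetition counts [j] and m - j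
    - 1; this is why [For] provides both. *)
Definition print_ticks (d : nat) (s : nat -> symbol (stack_index M)) : program :=
  Seq (For d (print (bit_table (s 0) 1)))
    (Seq (print (bit_table (s 0) 0)) (For d.+1 (print (bit_table (s 1) 0)))).

(* In an environment of size [d], the variables [0], [vm], [vl] and [vN] hold
   the length [n] of the input, [m], [m - n] and the number of symbols of arity 2. *)
Definition print_instance (d vm vl vN : nat) : program :=
  Seq (Seq (print [:: 1; 1]) (Seq (print_var 1 vN) (print [:: 0])))
 (Seq (For vN (print [:: 2]))
 (Seq (Seq (print [:: 0]) (print_var 1 vm))
 (Seq (Seq (print (control_base M))
      (Seq (For 0 (IfBit d.+1 (print (load_table M (Bit true)))
                              (print (load_table M (Bit false)))))
      (Seq (For vl (print (load_table M End)))
      (Seq (For vm (print (next_table M)))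
           (print [:: 1])))))
 (Seq (For vm
      (Seq (print (bit_base M))
      (Seq (print_ticks d Fill)
      (Seq (print_ticks d Next)
           (print [:: 1])))))
 (Seq (Seq (print [:: 2; 0]) (Seq (print_var 2 vN) (print [:: 0; 0; 0; 9; 1; 1; 1; 0])))
      (For vN (Seq (print [:: 1; 1]) (Seq (print_var 1 d) (print [:: 9; 1; 9; 1]))))))))).

Lemma exec_print_ticks w env d j r s : nth 0 env d = j -> nth 0 env d.+1 = r ->
  exec w env (print_ticks d s) = unary (tick_code j r s).
Proof.
move=> Ej Er; apply: exec_seq; first by apply: exec_repeat Ej _ => i _; exact: exec_print.
apply: exec_seq; first exact: exec_print.
by apply: exec_repeat Er _ => i _; exact: exec_print.
Qed.

Lemma exec_print_instance w env d vm vl vN m :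
  size env = d -> nth 0 env 0 = size w -> nth 0 env vm = m ->
  nth 0 env vl = m - size w -> nth 0 env vN = num_base M + (m + m) ->
  exec w env (print_instance d vm vl vN) = unary (instance_code M w m).
Proof.
move=> Ed E0 Em El EN; set N := num_base M + (m + m).
have nth_d i r : nth 0 (env ++ [:: i; r]) d = i by rewrite nth_cat -Ed ltnn subnn.
have nth_d1 i r : nth 0 (env ++ [:: i; r]) d.+1 = r by rewrite nth_cat -Ed ltnNge leqnSn /= subSnn.
apply: exec_seq.
  rewrite -[[:: 1; 1; _; 0]]/([:: 1; 1] ++ [:: 1 + N] ++ [:: 0]).
  apply: exec_seq; first exact: exec_print.
  by apply: exec_seq; rewrite ?exec_print // exec_print_var EN.
apply: exec_seq; first by apply: exec_repeat EN _ => i _; exact: exec_print.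
apply: exec_seq.
  rewrite -[[:: 0; _]]/([:: 0] ++ [:: 1 + m]).
  by apply: exec_seq; rewrite ?exec_print // exec_print_var Em.
apply: exec_seq.
  apply: exec_seq; first exact: exec_print.
  apply: exec_seq.
    (* The number of rounds left, [size w - i.+1], is the position of the letter loaded at step
       [i]. *)
    apply: exec_for E0 _ => i lt_i; rewrite [LHS]/exec -/exec nth_d1.
    by case: (nth false w _); exact: exec_print.
  apply: exec_seq; first by apply: exec_repeat El _ => i _; exact: exec_print.
  apply: exec_seq; last exact: exec_print.
  by apply: exec_repeat Em _ => i _; exact: exec_print.
apply: exec_seq.
  apply: exec_for Em _ => j lt_j; apply: exec_seq; first exact: exec_print.
  apply: exec_seq; first exact: exec_print_ticks.
  by apply: exec_seq; [exact: exec_print_ticks|exact: exec_print].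
apply: exec_seq.
  rewrite -[[:: 2, 0, _ & _]]/([:: 2; 0] ++ [:: 2 + N] ++ [:: 0; 0; 0; 9; 1; 1; 1; 0]).
  apply: exec_seq; first exact: exec_print.
  by apply: exec_seq; rewrite ?exec_print // exec_print_var EN.
apply: exec_for EN _ => i lt_i; rewrite /rule_code.
rewrite -[[:: 1, 1, _ & _]]/([:: 1; 1] ++ [:: 1 + i] ++ [:: 9; 1; 9; 1]).
apply: exec_seq; first exact: exec_print.
by apply: exec_seq; rewrite ?exec_print // exec_print_var nth_d.
Qed.

Lemma scoped_print_instance d vm vl vN : 0 < d -> vm < d -> vl < d -> vN < d ->
  scoped d (print_instance d vm vl vN).
Proof.
have sc d' s : scoped d' (print s) by exact: scoped_print_bits.
have scv d' c v : v < d' -> scoped d' (print_var c v).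
  by move=> lt_v; rewrite /print_var /= scoped_print_bits lt_v.
Local Opaque print print_var.
move=> lt0 ltm ltl ltN; have lt_d2 := ltnW (ltnSn d.+1).
by rewrite /= !sc !scv //= lt0 ltm ltl ltN !ltnSn lt_d2.
Qed.

(* Variable [v] being the last one, multiplies it [e] times by variable [0]. *)
Fixpoint power (v e : nat) (g : program) : program :=
  if e is e'.+1 then LetMul v 0 (power v.+1 e' g) else g.

Lemma scoped_power v e g : scoped v.+1 (power v e g) = scoped (v + e).+1 g.
Proof.
elim: e v => [|e IH] v; first by rewrite addn0.
by rewrite /= ltnSn IH addSnnS.
Qed.

(** The intermediate powers stay in the environment but are left unspecified; later code needs only
    the old variables and the last one. *)
Lemma exec_power w env v e g : size env = v.+1 -> exists env',
  [/\ exec w env (power v e g) = exec w env' g, size env' = (v + e).+1,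
      forall u, u <= v -> nth 0 env' u = nth 0 env u
    & nth 0 env' (v + e) = nth 0 env v * nth 0 env 0 ^ e].
Proof.
elim: e env v => [|e IH] env v Ev.
  by exists env; rewrite addn0 muln1.
have [|env' [E sz Eu Ee]] := IH (rcons env (nth 0 env v * nth 0 env 0)) v.+1.
  by rewrite size_rcons Ev.
exists env'; split; rewrite -?addSnnS //.
  by move=> u le_uv; rewrite Eu ?nth_rcons ?Ev ?ltnS ?le_uv // leqW.
by rewrite Ee !nth_rcons Ev ltnn eqxx /= expnS mulnA.
Qed.

(** The factor 2^(n+1) covers loading and 2^(n^e + e) the running time; the additional bit doubles
    their product, which then dominates their sum. *)
Definition num_bits (e n : nat) : nat := (n + 1) + (n ^ e + e.+1).

(** Variable [e.+1] holds n^e. From [d] on the variables hold e + 1, n^e + e + 1, n + 1, m, 2m,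
    [num_base M], the number of binary symbols, and m - n. The last is obtained as 1 + (n^e + e +
    1), there being no subtraction. *)
Definition reduction_program (e : nat) : program :=
  let d := e.+2 in
  LetC 1 (power 1 e
    (LetC e.+1 (LetAdd e.+1 (d + 0) (LetAdd 0 1 (LetAdd (d + 2) (d + 1)
    (LetAdd (d + 3) (d + 3) (LetC (num_base M) (LetAdd (d + 5) (d + 4)
    (LetAdd 1 (d + 1) (print_instance (d + 8) (d + 3) (d + 7) (d + 6))))))))))).

Lemma scoped_reduction_program e : scoped 1 (reduction_program e).
Proof.
Local Opaque print_instance.
rewrite /= scoped_power /= !addn0; do !(apply/andP; split; first by lia).
rewrite [X in scoped X _](_ : _ = e.+2 + 8); last by lia.
by apply: scoped_print_instance; lia.
Qed.

Lemma exec_reduction_program e w :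
  exec w [:: size w] (reduction_program e) =
  encode (reduction_instance M k w (num_bits e (size w))).
Proof.
rewrite /encode enc_reduction; last by rewrite /num_bits; lia.
set m := num_bits e (size w); rewrite /reduction_program; set d := e.+2.
set g := LetC e.+1 _.
have [env [Eg sz Eu Ee]] := @exec_power w [:: size w; 1] 1 e g (erefl _).
rewrite -[LHS]/(exec w [:: size w; 1] (power 1 e g)) {}Eg /g.
have nth_new s i : nth 0 (env ++ s) (d + i) = nth 0 s i.
  by rewrite nth_cat sz ltnNge leq_addr /= addKn.
have nth_old s u : u <= e.+1 -> nth 0 (env ++ s) u = nth 0 env u.
  by move=> le_u; rewrite nth_cat sz ltnS le_u.
have letC s c g' : exec w (env ++ s) (LetC c g') = exec w (env ++ rcons s c) g'.
  by rewrite /= rcons_cat.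
have letA s a b g' : exec w (env ++ s) (LetAdd a b g') =
    exec w (env ++ rcons s (nth 0 (env ++ s) a + nth 0 (env ++ s) b)) g'.
  by rewrite /= rcons_cat.
have E0 s : nth 0 (env ++ s) 0 = size w by rewrite nth_old // Eu.
have E1 s : nth 0 (env ++ s) 1 = 1 by rewrite nth_old // Eu.
have E2 s : nth 0 (env ++ s) e.+1 = size w ^ e by rewrite nth_old // Ee mul1n.
rewrite -[env in exec w env _]cats0 letC letA nth_new E2 letA E0 E1 letA !nth_new.
rewrite letA !nth_new letC letA !nth_new letA E1 !nth_new /=.
apply: exec_print_instance.
- by rewrite size_cat sz.
- exact: E0.
- by rewrite nth_new.
- by rewrite nth_new /= /m /num_bits; lia.
- by rewrite nth_new.
Qed.

End Printer.

Theorem theorem8p2 (k : nat) : 4 < k -> EXPTIME_hard (query_realizability k).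
Proof.
move=> _ L [e [M decM]].
exists (fun w => encode (reduction_instance M k w (num_bits e (size w)))); split.
  have [c [N compN]] := polytime_exec (scoped_reduction_program M e).
  exists c, N => w; have [t [le_t halt_t out_t]] := compN w.
  by exists t; rewrite -exec_reduction_program.
move=> w; have [t [le_t halt_t <-]] := decM w.
have le_bits : 2 ^ (size w).+1 + t <= 2 ^ num_bits e (size w).
  apply: leq_trans (leq_add (leqnn _) le_t) _.
  set a := 2 ^ _; set x := 2 ^ _.
  have -> : 2 ^ num_bits e (size w) = a * (2 * x).
    by rewrite /num_bits addn1 addnS expnD; congr (_ * _); rewrite expnS.
  have a2 : 2 <= a by rewrite /a expnS; have := expn_gt0 2 (size w); lia.
  have x1 : 0 < x by rewrite expn_gt0.
  have := leq_mul (leqnn a) x1; have := leq_mul a2 (leqnn x).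
  (* From a >= 2 and x >= 1 follow a <= ax and 2x <= ax, so a + x is at most 2ax. *)
  by rewrite muln1 [a * (2 * x)]mulnCA; lia.
have <- := realizable_decides k halt_t le_bits.
split=> [real|[I [/encode_inj <-]] //].
by exists (reduction_instance M k w (num_bits e (size w))).
Qed.
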